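(* Let $S\subseteq\mathbb Z^d$ be a standard semigroup, let $T_\bullet$ be a $p$-system of ideals of $S$, and let $H$ be any truncating halfspace for $\operatorname{cone}(S)$. Then \[\lim_{q\to\infty}\frac{\#(T_q\cap qH)}{q^d}=\operatorname{vol}_{\mathbb R^d}\big(\Delta(S,T_\bullet)\cap H\big).\]
   Context: $p$ prime; $q$ ranges over powers $p^e$, $e\ge0$. A semigroup is a subset of $\mathbb Z^d$ containing $0$ and closed under addition; an ideal of a semigroup $S$ is a subset $T\subseteq S$ with $S+T\subseteq T$. $\operatorname{cone}(U)$ is the closure of the set of nonnegative real linear combinations of elements of $U$. A closed convex cone $C\subseteq\mathbb R^d$ is pointed if there exists $\mathbf b\in\mathbb R^d$ with $\langle\mathbf u,\mathbf b\rangle>0$ for all nonzero $\mathbf u\in C$; for such $\mathbf b$ and a real $\alpha\ge0$, $H=\{\mathbf u\in\mathbb R^d:\langle\mathbf u,\mathbf b\rangle<\alpha\}$ is called a truncating halfspace for $C$. A semigroup $S$ is standard if $S-S=\mathbb Z^d$ and $\operatorname{cone}(S)$ is pointed. A $p$-system of ideals of $S$ is a sequence $T_\bullet=\{T_q\}$ of ideals of $S$ indexed by powers $q$ of $p$ with $pT_q\subseteq T_{pq}$ for all $q$. The $p$-body is $\Delta(S,T_\bullet)=\bigcup_q\big(\tfrac1qT_q+\operatorname{cone}(S)\big)$ (Minkowski sums). $qH=\{q\mathbf u:\mathbf u\in H\}$; $\operatorname{vol}_{\mathbb R^d}$ is Lebesgue measure. *)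

(* Defs.v *)
(* classical reals.  Points of Z^d / R^d are encoded as
   functions nat -> Z / nat -> R whose coordinates are only read for i < d
   (lattice points are moreover required to vanish for i >= d). *)
From Stdlib Require Import Reals Lra ZArith Znumtheory List.
Open Scope R_scope.

Fixpoint rsum (n : nat) (f : nat -> R) : R :=
  match n with O => 0 | S m => rsum m f + f m end.
Fixpoint rprod (n : nat) (f : nat -> R) : R :=
  match n with O => 1 | S m => rprod m f * f m end.

Definition dot (d : nat) (u v : nat -> R) : R := rsum d (fun i => u i * v i).

Definition Zpt (d : nat) (z : nat -> Z) : Prop := forall i, (d <= i)%nat -> z i = 0%Z.
Definition Rpt (d : nat) (x : nat -> R) : Prop := forall i, (d <= i)%nat -> x i = 0.
Definition inj (z : nat -> Z) : nat -> R := fun i => IZR (z i).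

Definition zadd (s t : nat -> Z) : nat -> Z := fun i => (s i + t i)%Z.
Definition zsub (s t : nat -> Z) : nat -> Z := fun i => (s i - t i)%Z.

Definition is_semigroup (d : nat) (S : (nat -> Z) -> Prop) : Prop :=
  (forall s, S s -> Zpt d s) /\ S (fun _ => 0%Z) /\
  (forall s t, S s -> S t -> S (zadd s t)).

Definition is_ideal (S T : (nat -> Z) -> Prop) : Prop :=
  (forall t, T t -> S t) /\ (forall s t, S s -> T t -> T (zadd s t)).

Inductive ncomb (U : (nat -> R) -> Prop) : (nat -> R) -> Prop :=
| ncomb0 : ncomb U (fun _ => 0)
| ncombS : forall x c u, 0 <= c -> U u -> ncomb U x ->
    ncomb U (fun i => x i + c * u i).

Definition cone (d : nat) (U : (nat -> R) -> Prop) (x : nat -> R) : Prop :=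
  Rpt d x /\
  forall eps, 0 < eps -> exists y, ncomb U y /\
    rsum d (fun i => Rabs (x i - y i)) < eps.

Definition Scone (d : nat) (S : (nat -> Z) -> Prop) : (nat -> R) -> Prop :=
  cone d (fun x => exists s, S s /\ x = inj s).

Definition pointing_vector (d : nat) (C : (nat -> R) -> Prop) (b : nat -> R) : Prop :=
  forall u, C u -> (exists i, (i < d)%nat /\ u i <> 0) -> dot d u b > 0.

Definition pointed (d : nat) (C : (nat -> R) -> Prop) : Prop :=
  exists b, pointing_vector d C b.

Definition standard (d : nat) (S : (nat -> Z) -> Prop) : Prop :=
  is_semigroup d S /\
  (forall z, Zpt d z -> exists s t, S s /\ S t /\ z = zsub s t) /\
  pointed d (Scone d S).

(* p-system: T e is the ideal T_q for q = p^e; p T_q ⊆ T_{pq} *)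
Definition p_system (p : nat) (S : (nat -> Z) -> Prop)
    (T : nat -> (nat -> Z) -> Prop) : Prop :=
  (forall e, is_ideal S (T e)) /\
  (forall e t, T e t -> T (e + 1)%nat (fun i => (Z.of_nat p * t i)%Z)).

Definition p_body (d p : nat) (S : (nat -> Z) -> Prop)
    (T : nat -> (nat -> Z) -> Prop) (x : nat -> R) : Prop :=
  exists e t c, T e t /\ Scone d S c /\
    x = (fun i => inj t i / INR (p ^ e) + c i).

Definition has_card (P : (nat -> Z) -> Prop) (n : nat) : Prop :=
  exists l : list (nat -> Z), NoDup l /\ (forall z, In z l <-> P z) /\ length l = n.

(* Lebesgue outer measure on R^d via countable covers by closed boxes.
   A cover is a sequence of boxes [a k i, b k i] (i < d), each possibly unused. *)
Definition box_vol (d : nat) (a b : nat -> nat -> R) (k : nat) : R :=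
  rprod d (fun i => b k i - a k i).

Definition cover_sum (d : nat) (A : (nat -> R) -> Prop) (s : R) : Prop :=
  exists (used : nat -> bool) (a b : nat -> nat -> R),
    (forall k i, used k = true -> (i < d)%nat -> a k i <= b k i) /\
    (forall x, A x -> exists k, used k = true /\
        forall i, (i < d)%nat -> a k i <= x i <= b k i) /\
    Un_cv (fun n => sum_f_R0 (fun k => if used k then box_vol d a b k else 0) n) s.

Definition is_inf (E : R -> Prop) (m : R) : Prop :=
  (forall s, E s -> m <= s) /\ (forall m', (forall s, E s -> m' <= s) -> m' <= m).

Definition volume (d : nat) (A : (nat -> R) -> Prop) (v : R) : Prop :=
  is_inf (cover_sum d (fun x => Rpt d x /\ A x)) v.

(* Main.v *)
(* Write [m = p^k] and [q = p^e], and let [E] be the part of the p-body below the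
   hyperplane; [E] is bounded because the pointing vector is coercive on the cone.
   Call a cell of the grid [(1/m) Z^d] outer if it meets [E], and inner if it lies
   in [E] and, for [q] large, all of its points in [(1/q) Z^d] lie in [(1/q) T_q].
   For [k] fixed and [e] large, both the volume of [E] and the normalised count
   lie between (number of inner cells)/m^d and (number of outer cells)/m^d.

   These bounds are close. Since [S - S = Z^d], there is [s0] in [S] such that
   [n s0 + v] is in [S] whenever all the coordinates of [v] are at most [n] in
   absolute value. If a cell meets [E] in [x = t/q0 + c], rounding an approximation of
   [c] by a nonnegative combination of elements of [S] shows that the cell translated
   by [3 s0] is inner, unless it crosses the hyperplane bounding [E]. The crossing
   cells lie in a slab of bounded width, so there are only [O(m^(d-1))] of them. *)
Require Import Defs.
From Stdlib Require Import Reals ZArith Znumtheory List.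
From Stdlib Require Import Lra Lia Classical ClassicalEpsilon FunctionalExtensionality.
Open Scope R_scope.

(** The volume is an infimum over countable covers: a finite cover bounds it from above, but a lower
    bound must hold against every cover. The analytic core is therefore that boxes covering a box
    have at least its total volume. Lower bounds for the body follow by complementing inside a cube,
    so measurability of the p-body never has to be discussed. The same bisection principle yields
    this fact and the coercivity of the pointing vector.

    The translation of cells answers an arithmetic obstacle. A point of the cone is only a limit of
    real combinations, and near the boundary of the cone the semigroup may have gaps at every scale.
    Moving inwards by a multiple of [s0 / m] makes room for errors that, after scaling by [q], are
    of order [q / m] or bounded. Translation is injective on cells, so the numbers of outer and
    inner cells differ by at most the number of crossing cells. *)

(** * Finite sums and products *)

Lemma rsum_ext n f g :
  (forall i, (i < n)%nat -> f i = g i) -> rsum n f = rsum n g.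
Proof.
  induction n as [|n IH]; intros H; simpl; [easy|].
  rewrite IH, H; auto with arith.
Qed.

Lemma rsum_le n f g :
  (forall i, (i < n)%nat -> f i <= g i) -> rsum n f <= rsum n g.
Proof.
  induction n as [|n IH]; intros H; simpl; [lra|].
  apply Rplus_le_compat; auto with arith.
Qed.

Lemma rsum_plus n f g : rsum n (fun i => f i + g i) = rsum n f + rsum n g.
Proof. induction n as [|n IH]; simpl; [|rewrite IH]; ring. Qed.

Lemma rsum_scal n a f : rsum n (fun i => a * f i) = a * rsum n f.
Proof. induction n as [|n IH]; simpl; [|rewrite IH]; ring. Qed.

Lemma rsum_const n a : rsum n (fun _ => a) = INR n * a.
Proof.
  induction n as [|n IH]; [simpl; ring|].
  rewrite S_INR; simpl rsum; rewrite IH; ring.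
Qed.

Lemma rsum_nonneg n f : (forall i, (i < n)%nat -> 0 <= f i) -> 0 <= rsum n f.
Proof.
  intros H; rewrite <- (Rmult_0_r (INR n)), <- rsum_const; now apply rsum_le.
Qed.

Lemma rsum_term_le n f i :
  (forall j, (j < n)%nat -> 0 <= f j) -> (i < n)%nat -> f i <= rsum n f.
Proof.
  induction n as [|n IH]; intros Hf Hi; [lia|]; simpl.
  destruct (Nat.eq_dec i n) as [->|Hn].
  - assert (0 <= rsum n f) by (apply rsum_nonneg; auto with arith); lra.
  - assert (f i <= rsum n f) by (apply IH; [auto with arith|lia]).
    assert (0 <= f n) by auto with arith; lra.
Qed.

Lemma dot_plus d u v b : dot d (fun i => u i + v i) b = dot d u b + dot d v b.
Proof.
  unfold dot; rewrite <- rsum_plus; apply rsum_ext; intros; ring.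
Qed.

Lemma dot_scal d a u b : dot d (fun i => a * u i) b = a * dot d u b.
Proof.
  unfold dot; rewrite <- rsum_scal; apply rsum_ext; intros; ring.
Qed.

Lemma dot_ext d u v b :
  (forall i, (i < d)%nat -> u i = v i) -> dot d u b = dot d v b.
Proof. intros H; apply rsum_ext; intros i Hi; now rewrite H. Qed.

Definition norm1 (d : nat) (u : nat -> R) : R := rsum d (fun i => Rabs (u i)).

Lemma norm1_nonneg d u : 0 <= norm1 d u.
Proof. apply rsum_nonneg; intros; apply Rabs_pos. Qed.

Lemma coord_le_norm1 d u i : (i < d)%nat -> Rabs (u i) <= norm1 d u.
Proof.
  apply (rsum_term_le d (fun i => Rabs (u i))); intros; apply Rabs_pos.
Qed.

Lemma dot_le d u b eta :
  (forall i, (i < d)%nat -> Rabs (u i) <= eta) ->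
  Rabs (dot d u b) <= eta * norm1 d b.
Proof.
  unfold dot, norm1; induction d as [|d IH]; intros H; simpl.
  - rewrite Rabs_R0; lra.
  - eapply Rle_trans; [apply Rabs_triang|].
    rewrite Rmult_plus_distr_l; apply Rplus_le_compat; [auto with arith|].
    rewrite Rabs_mult; apply Rmult_le_compat_r; [apply Rabs_pos|]; auto.
Qed.

Lemma rprod_nonneg n f : (forall i, (i < n)%nat -> 0 <= f i) -> 0 <= rprod n f.
Proof.
  induction n as [|n IH]; intros H; simpl; [lra|].
  apply Rmult_le_pos; auto with arith.
Qed.

Lemma rprod_pos n f : (forall i, (i < n)%nat -> 0 < f i) -> 0 < rprod n f.
Proof.
  induction n as [|n IH]; intros H; simpl; [lra|].
  apply Rmult_lt_0_compat; auto with arith.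
Qed.

Lemma rprod_ext n f g :
  (forall i, (i < n)%nat -> f i = g i) -> rprod n f = rprod n g.
Proof.
  induction n as [|n IH]; intros H; simpl; [easy|].
  rewrite IH, H; auto with arith.
Qed.

Lemma rprod_le n f g :
  (forall i, (i < n)%nat -> 0 <= f i <= g i) -> rprod n f <= rprod n g.
Proof.
  induction n as [|n IH]; intros H; simpl; [lra|].
  apply Rmult_le_compat; auto with arith.
  - apply rprod_nonneg; intros; apply H; lia.
  - apply H; lia.
  - apply H; lia.
Qed.

Lemma rprod_const n a : rprod n (fun _ => a) = a ^ n.
Proof. induction n as [|n IH]; simpl; [|rewrite IH]; ring. Qed.

(** A product is linear in each single factor. This makes volumes additive when a box is cut along
    one axis. *)
Lemma rprod_split n f g h i :
  (i < n)%nat -> f i = g i + h i ->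
  (forall j, j <> i -> f j = g j /\ f j = h j) ->
  rprod n f = rprod n g + rprod n h.
Proof.
  intros Hi Hsum Hoff; induction n as [|n IH]; [lia|]; simpl.
  destruct (Nat.eq_dec i n) as [->|Hn].
  - rewrite Hsum, <- (rprod_ext n f g), <- (rprod_ext n f h); [ring| |];
      intros j Hj; apply Hoff; lia.
  - destruct (Hoff n) as [Hg Hh]; [lia|].
    rewrite IH, <- Hg, <- Hh; [ring|lia].
Qed.

(* By convexity in [eta], the secant over [[0, 1]] bounds the product. *)
Lemma rprod_enlarge n l c eta :
  0 <= eta <= 1 -> 0 <= c -> (forall i, (i < n)%nat -> 0 <= l i) ->
  rprod n (fun i => l i + eta * c)
    <= rprod n l + eta * (rprod n (fun i => l i + c) - rprod n l).
Proof.
  intros Heta Hc; induction n as [|n IH]; intros Hl; simpl; [lra|].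
  assert (HP : 0 <= rprod n l) by (apply rprod_nonneg; auto with arith).
  assert (HQ : rprod n l <= rprod n (fun i => l i + c)).
  { apply rprod_le; intros i Hi; specialize (Hl i); split; [apply Hl; lia|].
    lra. }
  assert (Hn : 0 <= l n) by auto with arith.
  specialize (IH ltac:(auto with arith)).
  set (P := rprod n l) in *; set (Q := rprod n (fun i => l i + c)) in *.
  eapply Rle_trans.
  { apply Rmult_le_compat_r; [|apply IH]; nra. }
  assert (0 <= eta * (c * (Q - P) * (1 - eta))).
  { repeat apply Rmult_le_pos; lra. }
  nra.
Qed.

Lemma Rabs_le_bounds (x y : R) : Rabs x <= y -> - y <= x <= y.
Proof. unfold Rabs; destruct (Rcase_abs x); lra. Qed.

Lemma floor_exists (r : R) : exists n : Z, IZR n <= r < IZR n + 1.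
Proof.
  exists (up r - 1)%Z; rewrite minus_IZR.
  destruct (archimed r); lra.
Qed.

Lemma nat_above (r : R) : exists n : nat, (0 < n)%nat /\ r < INR n.
Proof.
  destruct (INR_unbounded r) as [n Hn].
  exists (Datatypes.S n); split; [lia|]; rewrite S_INR; lra.
Qed.

(** * Bisection of boxes *)

Definition set_at {A} (u : nat -> A) (i : nat) (a : A) : nat -> A :=
  fun j => if Nat.eq_dec j i then a else u j.

Lemma set_at_same {A} (u : nat -> A) i a : set_at u i a i = a.
Proof. unfold set_at; now destruct (Nat.eq_dec i i). Qed.

Lemma set_at_other {A} (u : nat -> A) i a j : j <> i -> set_at u i a j = u j.
Proof. unfold set_at; now destruct (Nat.eq_dec j i). Qed.

Definition in_box (d : nat) (lo hi x : nat -> R) : Prop :=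
  forall i, (i < d)%nat -> lo i <= x i <= hi i.

Definition bisectable (d : nat) (P : (nat -> R) -> (nat -> R) -> Prop) : Prop :=
  forall lo hi i, (i < d)%nat -> (forall j, (j < d)%nat -> lo j <= hi j) ->
    P lo hi ->
    P lo (set_at hi i ((lo i + hi i) / 2)) \/ P (set_at lo i ((lo i + hi i) / 2)) hi.

Definition half_box (d : nat) (lo hi lo' hi' : nat -> R) : Prop :=
  forall i, (i < d)%nat ->
    lo i <= lo' i /\ hi' i <= hi i /\ hi' i - lo' i = (hi i - lo i) / 2.

Lemma bisect_all d P lo hi :
  bisectable d P -> (forall j, (j < d)%nat -> lo j <= hi j) -> P lo hi ->
  exists lo' hi', P lo' hi' /\ half_box d lo hi lo' hi'.
Proof.
  intros HP Hle Hlh.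
  (* After [n] rounds the first [n] sides are halved and the others are still the original ones. *)
  enough (H : forall n, (n <= d)%nat -> exists lo' hi', P lo' hi' /\
    half_box n lo hi lo' hi' /\
    forall i, (n <= i)%nat -> lo' i = lo i /\ hi' i = hi i).
  { destruct (H d) as (lo' & hi' & H1 & H2 & _); [lia|]; now exists lo', hi'. }
  induction n as [|n IH]; intros Hn.
  { exists lo, hi; split; [easy|split; [intros i Hi; lia|easy]]. }
  destruct IH as (lo1 & hi1 & H1 & H2 & H3); [lia|].
  assert (Hle1 : forall j, (j < d)%nat -> lo1 j <= hi1 j).
  { intros j Hj; specialize (Hle j Hj); destruct (le_lt_dec n j) as [Hnj|Hnj].
    - destruct (H3 j Hnj) as [-> ->]; lra.
    - destruct (H2 j Hnj); lra. }
  destruct (H3 n (le_n n)) as [E1 E2]; specialize (Hle n Hn).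
  destruct (HP lo1 hi1 n Hn Hle1 H1) as [H4|H4].
  - exists lo1, (set_at hi1 n ((lo1 n + hi1 n) / 2)); split; [easy|split].
    + intros i Hi; destruct (Nat.eq_dec i n) as [->|Hin].
      * rewrite set_at_same, E1, E2; lra.
      * rewrite set_at_other by easy; apply H2; lia.
    + intros i Hi; rewrite set_at_other by lia; apply H3; lia.
  - exists (set_at lo1 n ((lo1 n + hi1 n) / 2)), hi1; split; [easy|split].
    + intros i Hi; destruct (Nat.eq_dec i n) as [->|Hin].
      * rewrite set_at_same, E1, E2; lra.
      * rewrite set_at_other by easy; apply H2; lia.
    + intros i Hi; rewrite set_at_other by lia; apply H3; lia.
Qed.

Lemma pow_half_small (r eta : R) : 0 < eta -> exists n, r * (1 / 2) ^ n <= eta.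
Proof.
  intros Heta.
  destruct (pow_lt_1_zero (1 / 2)) with (y := eta / (Rabs r + 1)) as [n Hn].
  - rewrite Rabs_pos_eq; lra.
  - apply Rdiv_lt_0_compat; [easy|]; pose proof (Rabs_pos r); lra.
  - exists n; specialize (Hn n (le_n n)).
    pose proof (Rabs_pos r) as Hr.
    rewrite Rabs_pos_eq in Hn by (apply pow_le; lra).
    apply Rle_trans with (Rabs r * (1 / 2) ^ n).
    + apply Rmult_le_compat_r; [apply pow_le; lra|apply Rle_abs].
    + apply (Rmult_lt_compat_r (Rabs r + 1)) in Hn; [|lra].
      unfold Rdiv at 2 in Hn; rewrite Rmult_assoc, Rinv_l, Rmult_1_r in Hn by lra.
      assert (0 < (1 / 2) ^ n) by (apply pow_lt; lra); nra.
Qed.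

(** Nested halved boxes shrink to a point near which [P] persists at every scale. This stands for
    compactness twice: of a box against countable covers, and of the unit vectors of a cone. *)
Theorem bisection d P lo hi :
  bisectable d P -> (forall j, (j < d)%nat -> lo j <= hi j) -> P lo hi ->
  exists x, Rpt d x /\ forall eta, 0 < eta ->
    exists lo' hi', P lo' hi' /\ in_box d lo' hi' x /\
      forall i, (i < d)%nat -> lo i <= lo' i /\ hi' i <= hi i /\ hi' i - lo' i <= eta.
Proof.
  intros HP Hle0 H0.
  set (good := fun B : (nat -> R) * (nat -> R) =>
    P (fst B) (snd B) /\ forall j, (j < d)%nat -> fst B j <= snd B j).
  assert (step : forall B : {B | good B}, {B' : {B | good B} |
      half_box d (fst (proj1_sig B)) (snd (proj1_sig B))
                 (fst (proj1_sig B')) (snd (proj1_sig B'))}).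
  { intros [[l h] [Hl Hh]]; apply constructive_indefinite_description; simpl in *.
    destruct (bisect_all d P l h HP Hh Hl) as (l' & h' & Hp & Hhalf).
    unshelve eexists (exist _ (l', h') _).
    - split; simpl; [easy|].
      intros j Hj; specialize (Hhalf j Hj); specialize (Hh j Hj); lra.
    - easy. }
  set (B := fix B n : {B | good B} := match n with
    | O => exist good (lo, hi) (conj H0 Hle0)
    | Datatypes.S m => proj1_sig (step (B m)) end).
  set (l := fun n => fst (proj1_sig (B n))).
  set (h := fun n => snd (proj1_sig (B n))).
  assert (Hgood : forall n, P (l n) (h n) /\ forall j, (j < d)%nat -> l n j <= h n j).
  { intros n; exact (proj2_sig (B n)). }
  assert (Hhalf : forall n, half_box d (l n) (h n) (l (Datatypes.S n)) (h (Datatypes.S n))).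
  { intros n; exact (proj2_sig (step (B n))). }
  assert (Hmono : forall n k i, (i < d)%nat ->
    l n i <= l (n + k)%nat i /\ h (n + k)%nat i <= h n i).
  { intros n k i Hi; induction k as [|k IH].
    - rewrite Nat.add_0_r; lra.
    - rewrite Nat.add_succ_r; destruct (Hhalf (n + k)%nat i Hi) as (? & ? & _); lra. }
  assert (Hcross : forall n k i, (i < d)%nat -> l n i <= h k i).
  { intros n k i Hi; destruct (Hmono n k i Hi) as [H1 _].
    destruct (Hmono k n i Hi) as [_ H2]; rewrite Nat.add_comm in H2.
    destruct (Hgood (n + k)%nat) as [_ H3]; specialize (H3 i Hi); lra. }
  assert (Hlen : forall n i, (i < d)%nat -> h n i - l n i = (hi i - lo i) * (1 / 2) ^ n).
  { intros n i Hi; induction n as [|n IH]; [unfold h, l; simpl; ring|].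
    destruct (Hhalf n i Hi) as (_ & _ & ->); rewrite IH; simpl; field. }
  assert (Hx : forall i, exists x, ((d <= i)%nat -> x = 0) /\
    ((i < d)%nat -> forall n, l n i <= x <= h n i)).
  { intros i; destruct (le_lt_dec d i) as [Hi|Hi].
    - exists 0; split; [easy|lia].
    - destruct (completeness (fun y => exists n, y = l n i)) as [x [Hub Hlub]].
      + exists (h O i); intros y [n ->]; now apply Hcross.
      + now exists (l O i), O.
      + exists x; split; [lia|]; intros _ n; split.
        * apply Hub; now exists n.
        * apply Hlub; intros y [k ->]; now apply Hcross. }
  set (x := fun i => proj1_sig (constructive_indefinite_description _ (Hx i))).
  assert (Hx' : forall i, ((d <= i)%nat -> x i = 0) /\
    ((i < d)%nat -> forall n, l n i <= x i <= h n i)).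
  { intros i; unfold x; now destruct (constructive_indefinite_description _ (Hx i)). }
  exists x; split; [intros i; apply Hx'|].
  intros eta Heta.
  (* The sum of all sides bounds each of them, so one number of halvings serves every coordinate. *)
  destruct (pow_half_small (rsum d (fun i => hi i - lo i)) eta Heta) as [n Hn].
  exists (l n), (h n); split; [apply Hgood|split].
  - intros i Hi; now apply Hx'.
  - intros i Hi; destruct (Hmono O n i Hi) as [H1 H2]; repeat split; try easy.
    rewrite Hlen by easy; eapply Rle_trans; [|apply Hn].
    apply Rmult_le_compat_r; [apply pow_le; lra|].
    apply (rsum_term_le d (fun i => hi i - lo i)); [|easy].
    intros j Hj; pose proof (Hle0 j Hj); lra.
Qed.

(** * Volume of covers *)

(** Length of the intersection of two intervals, zero when they are disjoint. *)
Definition overlap (a b lo hi : R) : R := Rmax 0 (Rmin b hi - Rmax a lo).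

Ltac overlap_cases :=
  unfold overlap, Rmax, Rmin;
  repeat match goal with |- context [Rle_dec ?x ?y] =>
    lazymatch constr:((x, y)) with
    | context [Rle_dec _ _] => fail
    | _ => destruct (Rle_dec x y)
    end
  end; lra.

Lemma overlap_split a b lo mid hi :
  lo <= mid <= hi -> overlap a b lo hi = overlap a b lo mid + overlap a b mid hi.
Proof.
  intros H; overlap_cases.
Qed.

Lemma overlap_nonneg a b lo hi : 0 <= overlap a b lo hi.
Proof. apply Rmax_l. Qed.

Lemma overlap_le a b lo hi : a <= b -> overlap a b lo hi <= b - a.
Proof.
  intros H; overlap_cases.
Qed.

Lemma overlap_inside a b lo hi :
  a <= lo -> lo <= hi -> hi <= b -> overlap a b lo hi = hi - lo.
Proof.
  intros H1 H2 H3; overlap_cases.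
Qed.

Definition overlap_vol (d : nat) (a b lo hi : nat -> R) : R :=
  rprod d (fun i => overlap (a i) (b i) (lo i) (hi i)).

Lemma overlap_vol_split d a b lo hi i mid :
  (i < d)%nat -> lo i <= mid <= hi i ->
  overlap_vol d a b lo hi
    = overlap_vol d a b lo (set_at hi i mid) + overlap_vol d a b (set_at lo i mid) hi.
Proof.
  intros Hi Hm; apply rprod_split with i; [easy| |].
  - rewrite !set_at_same; now apply overlap_split.
  - intros j Hj; now rewrite !set_at_other.
Qed.

Lemma side_prod_split d lo hi i mid :
  (i < d)%nat ->
  rprod d (fun j => hi j - lo j)
    = rprod d (fun j => set_at hi i mid j - lo j)
      + rprod d (fun j => hi j - set_at lo i mid j).
Proof.
  intros Hi; apply rprod_split with i; [easy| |].
  - rewrite !set_at_same; ring.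
  - intros j Hj; now rewrite !set_at_other.
Qed.

Definition opt_term (used : nat -> bool) (f : nat -> R) (k : nat) : R :=
  if used k then f k else 0.

Lemma sum_opt_nonneg used f n :
  (forall k, used k = true -> 0 <= f k) -> 0 <= sum_f_R0 (opt_term used f) n.
Proof.
  intros Hf; apply cond_pos_sum; intros k; unfold opt_term.
  specialize (Hf k); destruct (used k); [auto|lra].
Qed.

Lemma sum_opt_mono used f n m :
  (forall k, used k = true -> 0 <= f k) -> (n <= m)%nat ->
  sum_f_R0 (opt_term used f) n <= sum_f_R0 (opt_term used f) m.
Proof.
  intros Hf Hnm; induction Hnm as [|m Hnm IH]; [lra|]; simpl.
  assert (0 <= opt_term used f (Datatypes.S m)).
  { unfold opt_term; specialize (Hf (Datatypes.S m)).
    destruct (used (Datatypes.S m)); [auto|lra]. }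
  lra.
Qed.

Lemma sum_opt_term_le used f n :
  (forall k, used k = true -> 0 <= f k) -> used n = true ->
  f n <= sum_f_R0 (opt_term used f) n.
Proof.
  intros Hf Hn; assert (E : opt_term used f n = f n) by (unfold opt_term; now rewrite Hn).
  rewrite <- E; destruct n as [|n]; simpl; [lra|].
  pose proof (sum_opt_nonneg used f n Hf); lra.
Qed.

Lemma geometric_le_one n : sum_f_R0 (fun k => (1 / 2) ^ Datatypes.S k) n <= 1.
Proof.
  enough (H : sum_f_R0 (fun k => (1 / 2) ^ Datatypes.S k) n = 1 - (1 / 2) ^ Datatypes.S n).
  { rewrite H; assert (0 < (1 / 2) ^ Datatypes.S n) by (apply pow_lt; lra); lra. }
  induction n as [|n IH]; [simpl; lra|].
  rewrite tech5, IH; simpl; lra.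
Qed.

(* If some part of the box were covered too cheaply, halving it repeatedly
   would give such parts of arbitrarily small size around a point [x], but
   these eventually lie inside a single (slightly enlarged) box of the cover. *)
Lemma box_overlap_density d used a b lo hi theta :
  (forall j, (j < d)%nat -> lo j < hi j) -> theta < 1 ->
  (forall x, Rpt d x -> in_box d lo hi x -> exists k eta, used k = true /\ 0 < eta /\
     forall i, (i < d)%nat -> a k i + eta <= x i <= b k i - eta) ->
  exists n, theta * rprod d (fun i => hi i - lo i)
    < sum_f_R0 (opt_term used (fun k => overlap_vol d (a k) (b k) lo hi)) n.
Proof.
  intros Hlt Htheta Hcov; apply NNPP; intros Hno.
  assert (Hall : forall n, sum_f_R0 (opt_term used
      (fun k => overlap_vol d (a k) (b k) lo hi)) n
      <= theta * rprod d (fun i => hi i - lo i)).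
  { intros n; apply Rnot_lt_le; intros H; apply Hno; now exists n. }
  clear Hno.
  (* Sides stay strictly positive, so that comparing a volume with [theta] times itself is a
     contradiction at the end. *)
  set (P := fun l h => (forall j, (j < d)%nat -> l j < h j) /\
    forall n, sum_f_R0 (opt_term used (fun k => overlap_vol d (a k) (b k) l h)) n
      <= theta * rprod d (fun i => h i - l i)).
  assert (Hpos : forall l h k, used k = true -> 0 <= overlap_vol d (a k) (b k) l h).
  { intros; apply rprod_nonneg; intros; apply overlap_nonneg. }
  destruct (bisection d P lo hi) as (x & Hx & Hsmall); [| |now split|].
  - intros l h i Hi _ [Hlh Hsum].
    set (mid := (l i + h i) / 2).
    assert (Hmid : l i < mid < h i) by (specialize (Hlh i Hi); unfold mid; lra).
    apply NNPP; intros [N1 N2]%not_or_and.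
    assert (H1 : exists n1, theta * rprod d (fun j => set_at h i mid j - l j)
      < sum_f_R0 (opt_term used (fun k => overlap_vol d (a k) (b k) l (set_at h i mid))) n1).
    { apply NNPP; intros N; apply N1; split.
      - intros j Hj; destruct (Nat.eq_dec j i) as [->|Hji];
          [rewrite set_at_same; lra|rewrite set_at_other; auto].
      - intros n; apply Rnot_lt_le; intros Hn; apply N; now exists n. }
    assert (H2 : exists n2, theta * rprod d (fun j => h j - set_at l i mid j)
      < sum_f_R0 (opt_term used (fun k => overlap_vol d (a k) (b k) (set_at l i mid) h)) n2).
    { apply NNPP; intros N; apply N2; split.
      - intros j Hj; destruct (Nat.eq_dec j i) as [->|Hji];
          [rewrite set_at_same; lra|rewrite set_at_other; auto].
      - intros n; apply Rnot_lt_le; intros Hn; apply N; now exists n. }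
    (* Overlaps and volumes both add over the two halves; at index [n1 + n2] one partial sum shows
       both excesses. *)
    destruct H1 as [n1 H1], H2 as [n2 H2].
    specialize (Hsum (n1 + n2)%nat).
    rewrite (side_prod_split d l h i mid Hi) in Hsum.
    assert (E : sum_f_R0 (opt_term used (fun k => overlap_vol d (a k) (b k) l h)) (n1 + n2)
      = sum_f_R0 (opt_term used (fun k => overlap_vol d (a k) (b k) l (set_at h i mid))) (n1 + n2)
      + sum_f_R0 (opt_term used (fun k => overlap_vol d (a k) (b k) (set_at l i mid) h)) (n1 + n2)).
    { rewrite <- plus_sum; apply sum_eq; intros k _; unfold opt_term.
      destruct (used k); [|ring]; apply overlap_vol_split; [easy|lra]. }
    rewrite E in Hsum.
    assert (M1 := sum_opt_mono used _ n1 (n1 + n2) (Hpos l (set_at h i mid)) ltac:(lia)).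
    assert (M2 := sum_opt_mono used _ n2 (n1 + n2) (Hpos (set_at l i mid) h) ltac:(lia)).
    lra.
  - intros j Hj; specialize (Hlt j Hj); lra.
  - destruct (Hcov x Hx) as (k & eta & Hk & Heta & Hin).
    { destruct (Hsmall 1 ltac:(lra)) as (l & h & _ & Hb & Hsub).
      intros i Hi; specialize (Hb i Hi); specialize (Hsub i Hi); lra. }
    destruct (Hsmall eta Heta) as (l & h & [Hlh Hsum] & Hb & Hsub).
    (* The small box lies inside box [k], whose overlap with it is the full volume. *)
    specialize (Hsum k).
    assert (M := sum_opt_term_le used _ k (Hpos l h) Hk).
    assert (E : overlap_vol d (a k) (b k) l h = rprod d (fun i => h i - l i)).
    { apply rprod_ext; intros i Hi; specialize (Hin i Hi); specialize (Hb i Hi).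
      specialize (Hsub i Hi); specialize (Hlh i Hi).
      apply overlap_inside; lra. }
    simpl in M; rewrite E in M.
    assert (0 < rprod d (fun i => h i - l i)).
    { apply rprod_pos; intros i Hi; specialize (Hlh i Hi); lra. }
    nra.
Qed.

(** Enlarging box [k] by [eta k] on every side puts each point of the target well inside some box of
    the cover, at a total cost of at most [eps]. The density lemma then applies with
    [theta * V = s + eps]. *)
Theorem box_volume_le_cover d used a b lo hi s :
  (forall j, (j < d)%nat -> lo j < hi j) ->
  (forall k i, used k = true -> (i < d)%nat -> a k i <= b k i) ->
  (forall x, Rpt d x -> in_box d lo hi x ->
     exists k, used k = true /\ in_box d (a k) (b k) x) ->
  (forall n, sum_f_R0 (opt_term used (box_vol d a b)) n <= s) ->
  rprod d (fun i => hi i - lo i) <= s.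
Proof.
  intros Hlt Hab Hcov Hsum; apply Rnot_lt_le; intros Hs.
  set (V := rprod d (fun i => hi i - lo i)) in *.
  assert (HV : 0 < V) by (apply rprod_pos; intros i Hi; specialize (Hlt i Hi); lra).
  assert (Hvol : forall k, used k = true -> 0 <= box_vol d a b k).
  { intros k Hk; apply rprod_nonneg; intros i Hi; specialize (Hab k i Hk Hi); lra. }
  (* Half of the gap keeps [theta] below 1; the cap 1 keeps [eta k] in the range of the secant
     bound. *)
  set (eps := Rmin 1 ((V - s) / 2)).
  assert (Heps : 0 < eps <= 1 /\ eps <= (V - s) / 2).
  { unfold eps; pose proof (Rmin_l 1 ((V - s) / 2)); pose proof (Rmin_r 1 ((V - s) / 2)).
    assert (0 < Rmin 1 ((V - s) / 2)) by (apply Rmin_pos; lra); lra. }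
  (* Volume of box [k] enlarged by 1 on every side: the right end of the secant. *)
  set (Q := fun k => rprod d (fun i => (b k i - a k i) + 2)).
  assert (HQ : forall k, used k = true -> 0 <= Q k).
  { intros k Hk; apply rprod_nonneg; intros i Hi; specialize (Hab k i Hk Hi); lra. }
  set (eta := fun k => eps * (1 / 2) ^ Datatypes.S k / (1 + Q k)).
  assert (Hpow : forall k, 0 < (1 / 2) ^ k <= 1).
  { intros k; split; [apply pow_lt; lra|].
    apply Rle_trans with (1 ^ k); [apply pow_incr; lra|rewrite pow1; lra]. }
  assert (Heta : forall k, used k = true ->
    0 < eta k <= 1 /\ eta k * Q k <= eps * (1 / 2) ^ Datatypes.S k).
  { intros k Hk; specialize (HQ k Hk); specialize (Hpow (Datatypes.S k)).
    set (t := (1 / 2) ^ Datatypes.S k) in *.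
    assert (E : eta k * (1 + Q k) = eps * t) by (unfold eta; fold t; field; lra).
    assert (0 < eta k) by (unfold eta; fold t; apply Rdiv_lt_0_compat; nra).
    assert (eps * t <= 1) by nra.
    split; [split|]; nra. }
  set (a' := fun k i => a k i - eta k).
  set (b' := fun k i => b k i + eta k).
  destruct (box_overlap_density d used a' b' lo hi ((s + eps) / V)) as [n Hn]; [easy| | |].
  - apply Rmult_lt_reg_r with V; [easy|].
    replace ((s + eps) / V * V) with (s + eps) by (field; lra); lra.
  - intros x Hx Hin; destruct (Hcov x Hx Hin) as (k & Hk & Hkin).
    exists k, (eta k); split; [easy|split; [apply Heta, Hk|]].
    intros i Hi; specialize (Hkin i Hi); unfold a', b'; lra.
  - fold V in Hn; replace ((s + eps) / V * V) with (s + eps) in Hn by (field; lra).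
    assert (sum_f_R0 (opt_term used (fun k => overlap_vol d (a' k) (b' k) lo hi)) n
      <= sum_f_R0 (fun k => opt_term used (box_vol d a b) k
                             + (1 / 2) ^ Datatypes.S k * eps) n) as H.
    { apply sum_Rle; intros k _; unfold opt_term.
      specialize (Hpow (Datatypes.S k)); specialize (Hvol k).
      destruct (used k) eqn:Hk; [|nra].
      specialize (Heta k Hk); specialize (Hvol eq_refl).
      apply Rle_trans with (rprod d (fun i => (b k i - a k i) + eta k * 2)).
      - apply rprod_le; intros i Hi; split; [apply overlap_nonneg|].
        specialize (Hab k i Hk Hi).
        eapply Rle_trans; [apply overlap_le|]; unfold a', b'; lra.
      - eapply Rle_trans; [apply rprod_enlarge; [lra|lra|]|].
        + intros i Hi; specialize (Hab k i Hk Hi); lra.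
        + change (box_vol d a b k + eta k * (Q k - box_vol d a b k)
            <= box_vol d a b k + (1 / 2) ^ Datatypes.S k * eps).
          assert (0 <= eta k * box_vol d a b k) by (apply Rmult_le_pos; lra).
          lra. }
    rewrite plus_sum, <- scal_sum in H.
    pose proof (geometric_le_one n); specialize (Hsum n); nra.
Qed.

(** * Operations on covers *)

Lemma cover_sum_bound d A s :
  cover_sum d A s -> exists used a b,
    (forall k i, used k = true -> (i < d)%nat -> a k i <= b k i) /\
    (forall x, A x -> exists k, used k = true /\ in_box d (a k) (b k) x) /\
    (forall n, sum_f_R0 (opt_term used (box_vol d a b)) n <= s).
Proof.
  intros (used & a & b & Hab & Hcov & Hcv); exists used, a, b; repeat split; try easy.
  intros n; apply (growing_ineq (sum_f_R0 (opt_term used (box_vol d a b)))); [|easy].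
  intros m; apply sum_opt_mono; [|lia].
  intros k Hk; apply rprod_nonneg; intros i Hi; specialize (Hab k i Hk Hi); lra.
Qed.

Lemma cover_sum_nonneg d A s : cover_sum d A s -> 0 <= s.
Proof.
  intros (used & a & b & Hab & _ & Hsum)%cover_sum_bound.
  eapply Rle_trans; [|apply (Hsum O)]; apply sum_opt_nonneg.
  intros k Hk; apply rprod_nonneg; intros i Hi; specialize (Hab k i Hk Hi); lra.
Qed.

Lemma cover_sum_empty d : cover_sum d (fun _ => False) 0.
Proof.
  exists (fun _ => false), (fun _ _ => 0), (fun _ _ => 0); repeat split; try easy.
  intros eps Heps; exists O; intros n _.
  replace (sum_f_R0 _ n) with 0; [unfold Rdist; rewrite Rminus_diag, Rabs_R0; lra|].
  induction n as [|n IH]; simpl; [easy|]; rewrite <- IH; ring.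
Qed.

Lemma cover_sum_incl d (A B : (nat -> R) -> Prop) s :
  (forall x, A x -> B x) -> cover_sum d B s -> cover_sum d A s.
Proof.
  intros HAB (used & a & b & Hab & Hcov & Hcv); exists used, a, b; auto.
Qed.

Lemma cover_sum_cons d A s lo hi :
  (forall i, (i < d)%nat -> lo i <= hi i) -> cover_sum d A s ->
  cover_sum d (fun x => in_box d lo hi x \/ A x) (rprod d (fun i => hi i - lo i) + s).
Proof.
  intros Hle (used & a & b & Hab & Hcov & Hcv).
  exists (fun k => match k with O => true | Datatypes.S k => used k end),
    (fun k => match k with O => lo | Datatypes.S k => a k end),
    (fun k => match k with O => hi | Datatypes.S k => b k end).
  split; [intros [|k] i; auto|split].
  - intros x [Hx|Hx].
    + now exists O.
    + destruct (Hcov x Hx) as (k & Hk); now exists (Datatypes.S k).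
  - intros eps Heps; destruct (Hcv eps Heps) as [N HN].
    exists (Datatypes.S N); intros n Hn; destruct n as [|n]; [lia|].
    rewrite decomp_sum by lia; simpl pred.
    specialize (HN n ltac:(lia)); unfold Rdist in *.
    match goal with |- Rabs (?u + ?v - (?w + s)) < _ =>
      replace (u + v - (w + s)) with (v - s) by (unfold box_vol; ring) end.
    exact HN.
Qed.

(** The residual set [A] is empty when outer cells cover the body, and is the body itself when a
    cube is covered. *)
Lemma cover_sum_list {I} d (l : list I) lo hi v A s :
  (forall z i, (i < d)%nat -> lo z i <= hi z i) ->
  (forall z, rprod d (fun i => hi z i - lo z i) = v) -> cover_sum d A s ->
  cover_sum d (fun x => (exists z, In z l /\ in_box d (lo z) (hi z) x) \/ A x)
    (INR (length l) * v + s).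
Proof.
  intros Hle Hv HA; induction l as [|z l IH].
  - simpl; rewrite Rmult_0_l, Rplus_0_l; eapply cover_sum_incl; [|apply HA].
    intros x [(z & [] & _)|Hx]; easy.
  - simpl length; rewrite S_INR.
    replace ((INR (length l) + 1) * v + s) with
      (rprod d (fun i => hi z i - lo z i) + (INR (length l) * v + s))
      by (rewrite Hv; ring).
    eapply cover_sum_incl; [|apply cover_sum_cons; [apply Hle|apply IH]].
    intros x [(z' & [->|Hz'] & Hx)|Hx]; [now left| |now right; right].
    right; left; now exists z'.
Qed.

(** The infimum is minus the least upper bound of the negated cover sums: one cover gives
    nonemptiness, nonnegativity gives the bound. *)
Lemma volume_exists d A s : cover_sum d (fun x => Rpt d x /\ A x) s ->
  exists v, volume d A v.
Proof.
  intros Hs.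
  destruct (completeness (fun r => cover_sum d (fun x => Rpt d x /\ A x) (- r)))
    as [m [Hub Hlub]].
  - exists 0; intros r Hr; apply cover_sum_nonneg in Hr; lra.
  - exists (- s); now rewrite Ropp_involutive.
  - exists (- m); split.
    + intros r Hr; rewrite <- (Ropp_involutive r) in Hr; apply Hub in Hr; lra.
    + intros m' Hm'; apply Ropp_le_cancel; rewrite Ropp_involutive; apply Hlub.
      intros r Hr; apply Hm' in Hr; lra.
Qed.

(** * Counting lattice points *)

Definition at_most {A} (P : A -> Prop) (n : nat) : Prop :=
  exists l, (forall z, P z -> In z l) /\ (length l <= n)%nat.

Definition at_least {A} (P : A -> Prop) (n : nat) : Prop :=
  exists l, NoDup l /\ (forall z, In z l -> P z) /\ (n <= length l)%nat.

Definition decide (P : Prop) : bool :=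
  if excluded_middle_informative P then true else false.

Lemma decide_spec P : decide P = true <-> P.
Proof. unfold decide; destruct (excluded_middle_informative P); easy. Qed.

Lemma at_most_card (P : (nat -> Z) -> Prop) n :
  at_most P n -> exists k, has_card P k /\ (k <= n)%nat.
Proof.
  intros (l & Hl & Hn).
  assert (dec : forall x y : nat -> Z, {x = y} + {x <> y}).
  { intros x y; apply excluded_middle_informative. }
  set (l' := nodup dec (filter (fun z => decide (P z)) l)).
  assert (Hl' : forall z, In z l' <-> P z).
  { intros z; unfold l'; rewrite nodup_In, filter_In, decide_spec.
    specialize (Hl z); tauto. }
  exists (length l'); split.
  - exists l'; repeat split; try apply Hl'; apply NoDup_nodup.
  - apply Nat.le_trans with (length l); [|easy].
    apply NoDup_incl_length; [apply NoDup_nodup|].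
    intros z Hz; now apply Hl, Hl'.
Qed.

Lemma at_least_le_at_most {A} (P : A -> Prop) k n :
  at_least P k -> at_most P n -> (k <= n)%nat.
Proof.
  intros (l & Hnd & Hl & Hk) (l' & Hl' & Hn).
  assert (length l <= length l')%nat; [|lia].
  apply NoDup_incl_length; [easy|]; intros z Hz; auto.
Qed.

Lemma has_card_at_most P n : has_card P n -> at_most P n.
Proof. intros (l & _ & Hl & <-); exists l; split; [intros z; apply Hl|easy]. Qed.

Lemma has_card_at_least P n : has_card P n -> at_least P n.
Proof.
  intros (l & Hnd & Hl & <-); exists l; repeat split; [easy| |easy].
  intros z; apply Hl.
Qed.

Lemma at_most_incl {A} (P Q : A -> Prop) n :
  (forall z, P z -> Q z) -> at_most Q n -> at_most P n.
Proof. intros H (l & Hl & Hn); exists l; auto. Qed.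

Lemma at_most_or {A} (P Q : A -> Prop) m n :
  at_most P m -> at_most Q n -> at_most (fun z => P z \/ Q z) (m + n).
Proof.
  intros (l & Hl & Hm) (l' & Hl' & Hn); exists (l ++ l'); split.
  - intros z [H|H]; apply in_or_app; auto.
  - rewrite length_app; lia.
Qed.

Lemma at_most_preimage {A B} (f : A -> B) (g : B -> A) (P : A -> Prop) (Q : B -> Prop) n :
  (forall z, P z -> Q (f z) /\ g (f z) = z) -> at_most Q n -> at_most P n.
Proof.
  intros H (l & Hl & Hn); exists (map g l); split.
  - intros z [HQ <-]%H; apply in_map; auto.
  - now rewrite length_map.
Qed.

(** Union bound over the fibres of a relation. Covering is enough here, while the lower bound
    [at_least_fibers] needs disjoint fibres. *)
Lemma at_most_fibers {A B} (r : B -> A -> Prop) (P : A -> Prop) (Q : B -> Prop) m n :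
  (forall z, P z -> exists y, Q y /\ r y z) ->
  (forall y, at_most (fun z => P z /\ r y z) n) ->
  at_most Q m -> at_most P (m * n).
Proof.
  intros HP Hr (l & Hl & Hm).
  assert (H : at_most (fun z => exists y, In y l /\ (P z /\ r y z)) (length l * n)).
  { clear Hl Hm; induction l as [|y l IH].
    - exists nil; split; [intros z (y & [] & _)|easy].
    - simpl; eapply at_most_incl; [|apply at_most_or; [apply (Hr y)|apply IH]].
      intros z (y' & [->|Hy'] & Hz); [now left|right; eauto]. }
  destruct H as (l' & Hl' & Hn); exists l'; split.
  - intros z Hz; apply Hl'; destruct (HP z Hz) as (y & HQ & Hyz); eauto.
  - nia.
Qed.

Lemma at_least_fibers {A B} (r : B -> A -> Prop) (P : A -> Prop) (Q : B -> Prop) m n :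
  (forall y, Q y -> at_least (r y) n) ->
  (forall y z, Q y -> r y z -> P z) ->
  (forall y y' z, r y z -> r y' z -> y = y') ->
  at_least Q m -> at_least P (m * n).
Proof.
  intros Hr HP Hdisj (l & Hnd & Hl & Hm).
  enough (H : exists l', NoDup l' /\
    (forall z, In z l' -> exists y, In y l /\ r y z) /\ (length l * n <= length l')%nat).
  { destruct H as (l' & H1 & H2 & H3); exists l'; split; [easy|split].
    - intros z (y & Hy & Hz)%H2; apply HP with y; auto.
    - nia. }
  clear Hm; induction l as [|y l IH].
  - exists nil; repeat split; [constructor|easy|simpl; lia].
  - inversion Hnd as [|? ? Hy Hnd']; subst.
    destruct IH as (l1 & N1 & I1 & L1); [easy|intros; apply Hl; now right|].
    destruct (Hr y) as (l2 & N2 & I2 & L2); [apply Hl; now left|].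
    exists (l2 ++ l1); split; [|split].
    + apply NoDup_app; [easy|easy|].
      intros z Hz2 (y' & Hy' & Hz1)%I1; apply Hy.
      now rewrite (Hdisj y y' z (I2 z Hz2) Hz1).
    + intros z [Hz|Hz]%in_app_or.
      * exists y; split; [now left|auto].
      * destruct (I1 z Hz) as (y' & ? & ?); exists y'; split; [now right|easy].
    + rewrite length_app; simpl; lia.
Qed.

(** * Lattice points of boxes and slabs *)

Definition lattice_box (d : nat) (lo : nat -> Z) (n : nat) (z : nat -> Z) : Prop :=
  Zpt d z /\ forall i, (i < d)%nat -> (lo i <= z i < lo i + Z.of_nat n)%Z.

Definition interval_list (a : Z) (n : nat) : list Z :=
  map (fun j => (a + Z.of_nat j)%Z) (seq 0 n).

Lemma in_interval_list a n c :
  In c (interval_list a n) <-> (a <= c < a + Z.of_nat n)%Z.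
Proof.
  unfold interval_list; rewrite in_map_iff; split.
  - intros (j & <- & Hj%in_seq); lia.
  - intros H; exists (Z.to_nat (c - a)); rewrite in_seq; lia.
Qed.

Fixpoint lattice_box_list (d : nat) (lo : nat -> Z) (n : nat) : list (nat -> Z) :=
  match d with
  | O => (fun _ => 0%Z) :: nil
  | Datatypes.S m => map (fun zc => set_at (fst zc) m (snd zc))
      (list_prod (lattice_box_list m lo n) (interval_list (lo m) n))
  end.

Lemma Zpt_set_at d z c : Zpt d z -> Zpt (Datatypes.S d) (set_at z d c).
Proof. intros H i Hi; rewrite set_at_other by lia; apply H; lia. Qed.

Lemma set_at_Zpt d z : Zpt (Datatypes.S d) z -> Zpt d (set_at z d 0%Z).
Proof.
  intros H i Hi; destruct (Nat.eq_dec i d) as [->|Hid]; [apply set_at_same|].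
  rewrite set_at_other by easy; apply H; lia.
Qed.

Lemma set_at_set_at {A} (z : nat -> A) i a c : set_at (set_at z i a) i c = set_at z i c.
Proof.
  apply functional_extensionality; intros j; unfold set_at.
  now destruct (Nat.eq_dec j i).
Qed.

Lemma set_at_id {A} (z : nat -> A) i : set_at z i (z i) = z.
Proof.
  apply functional_extensionality; intros j; unfold set_at.
  now destruct (Nat.eq_dec j i) as [->|].
Qed.

Lemma set_at_eq {A} (z : nat -> A) i a : z i = a -> set_at z i a = z.
Proof. intros <-; apply set_at_id. Qed.

Lemma in_lattice_box_list d lo n z : In z (lattice_box_list d lo n) <-> lattice_box d lo n z.
Proof.
  revert z; induction d as [|d IH]; intros z; simpl.
  - split.
    + intros [<-|[]]; split; [easy|intros; lia].
    + intros [Hz _]; left; apply functional_extensionality; intros i.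
      symmetry; apply Hz; lia.
  - rewrite in_map_iff; split.
    + intros ([y c] & <- & [[Hy Hy']%IH Hc]%in_prod_iff).
      apply in_interval_list in Hc; simpl; split; [now apply Zpt_set_at|].
      intros i Hi; destruct (Nat.eq_dec i d) as [->|Hid]; [now rewrite set_at_same|].
      rewrite set_at_other by easy; apply Hy'; lia.
    + intros [Hz Hz']; exists (set_at z d 0%Z, z d); simpl; split.
      * now rewrite set_at_set_at, set_at_id.
      * apply in_prod_iff; rewrite IH, in_interval_list; split; [split|apply Hz'; lia].
        -- now apply set_at_Zpt.
        -- intros i Hi; rewrite set_at_other by lia; apply Hz'; lia.
Qed.

Lemma NoDup_list_product {A B} (l : list A) (l' : list B) :
  NoDup l -> NoDup l' -> NoDup (list_prod l l').
Proof.
  intros Hl Hl'; induction Hl as [|x l Hx Hl IH]; simpl; [constructor|].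
  apply NoDup_app; [|easy|].
  - apply NoDup_map_NoDup_ForallPairs; [|easy].
    intros a b _ _ E; congruence.
  - intros [a b] (b' & E & _)%in_map_iff [Ha _]%in_prod_iff; congruence.
Qed.

Lemma NoDup_lattice_box_list d lo n : NoDup (lattice_box_list d lo n).
Proof.
  induction d as [|d IH]; simpl; [repeat constructor; easy|].
  apply NoDup_map_NoDup_ForallPairs.
  - intros [y c] [y' c'] [[Hy _]%in_lattice_box_list _]%in_prod_iff
      [[Hy' _]%in_lattice_box_list _]%in_prod_iff E; simpl in E.
    assert (c = c') as <-.
    { rewrite <- (set_at_same y d c), E; apply set_at_same. }
    f_equal; rewrite <- (set_at_eq y d 0%Z), <- (set_at_eq y' d 0%Z);
      [|apply Hy'; lia|apply Hy; lia].
    now rewrite <- (set_at_set_at y d c), E, set_at_set_at.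
  - apply NoDup_list_product; [easy|].
    apply NoDup_map_NoDup_ForallPairs; [intros a b _ _; lia|apply seq_NoDup].
Qed.

Lemma length_lattice_box_list d lo n : length (lattice_box_list d lo n) = (n ^ d)%nat.
Proof.
  induction d as [|d IH]; [easy|]; simpl lattice_box_list.
  rewrite length_map, length_prod, IH; unfold interval_list.
  rewrite length_map, length_seq; simpl; lia.
Qed.

Lemma lattice_box_at_most d lo n : at_most (lattice_box d lo n) (n ^ d).
Proof.
  exists (lattice_box_list d lo n); split.
  - intros z; apply in_lattice_box_list.
  - now rewrite length_lattice_box_list.
Qed.

Lemma lattice_box_at_least d lo n : at_least (lattice_box d lo n) (n ^ d).
Proof.
  exists (lattice_box_list d lo n); split; [apply NoDup_lattice_box_list|split].
  - intros z; apply in_lattice_box_list.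
  - now rewrite length_lattice_box_list.
Qed.

Definition centered_box (d N : nat) : (nat -> Z) -> Prop :=
  lattice_box d (fun _ => (- Z.of_nat N)%Z) (2 * N).

Lemma at_most_Z_interval (A L : R) (k : nat) :
  L < INR k -> at_most (fun c => A <= IZR c <= A + L) (k + 1).
Proof.
  intros HL; destruct (floor_exists A) as [a Ha].
  exists (interval_list a (k + 1)); split;
    [|unfold interval_list; rewrite length_map, length_seq; lia].
  intros c Hc; apply in_interval_list.
  rewrite INR_IZR_INZ in HL.
  split; [assert (a - 1 < c)%Z; [|lia]|];
    apply lt_IZR; rewrite ?minus_IZR, ?plus_IZR, ?Nat2Z.inj_add, ?plus_IZR; simpl; lra.
Qed.

(** Along an axis where [b] is nonzero the slab leaves an interval of bounded length, so [K] depends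
    neither on the box nor on the position [A]. The induction strips final coordinates on which [b]
    vanishes. *)
Lemma slab_at_most d b L i :
  (i < d)%nat -> b i <> 0 ->
  exists K : nat, forall N A,
    at_most (fun z => centered_box d N z /\ A <= dot d (inj z) b <= A + L)
      ((2 * N) ^ (d - 1) * K).
Proof.
  intros Hi Hbi; induction d as [|d IH]; [lia|].
  replace (Datatypes.S d - 1)%nat with d by lia.
  destruct (Req_dec (b d) 0) as [Hbd|Hbd].
  - destruct IH as [K HK].
    { destruct (Nat.eq_dec i d) as [->|Hid]; [easy|lia]. }
    exists K; intros N A.
    (* Otherwise [i] would be the last coordinate, where [b] vanishes; hence [d - 1] is not
       truncated below. *)
    assert (d <> O) by (intros ->; replace i with O in * by lia; easy).
    replace ((2 * N) ^ d * K)%nat with ((2 * N) * ((2 * N) ^ (d - 1) * K))%nat.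
    2: { replace d with (Datatypes.S (d - 1)) at 2 by lia; simpl; lia. }
    apply (at_most_fibers (fun (c : Z) z => z d = c)) with
      (Q := fun c => In c (interval_list (- Z.of_nat N)%Z (2 * N))).
    + intros z [[Hz Hz'] _]; exists (z d); split; [|easy].
      apply in_interval_list, Hz'; lia.
    + intros c.
      refine (at_most_preimage (fun z => set_at z d 0%Z) (fun z => set_at z d c)
        _ _ _ _ (HK N A)).
      intros z [[[Hz Hz'] HA] Hc]; split; [split; [split|]|].
      * now apply set_at_Zpt.
      * intros j Hj; rewrite set_at_other by lia; apply Hz'; lia.
      * rewrite (dot_ext d _ (inj z)).
        -- unfold dot in HA; simpl in HA; rewrite Hbd, Rmult_0_r, Rplus_0_r in HA.
           exact HA.
        -- intros j Hj; unfold inj; now rewrite set_at_other by lia.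
      * rewrite set_at_set_at; now apply set_at_eq.
    + exists (interval_list (- Z.of_nat N)%Z (2 * N)); split; [easy|].
      unfold interval_list; now rewrite length_map, length_seq.
  - destruct (nat_above (L / Rabs (b d))) as (k & _ & Hk).
    exists (k + 1)%nat; intros N A.
    apply (at_most_fibers (fun y z => set_at z d 0%Z = y)) with (Q := centered_box d N).
    + intros z [[Hz Hz'] _]; exists (set_at z d 0%Z); split; [split|easy].
      * now apply set_at_Zpt.
      * intros j Hj; rewrite set_at_other by lia; apply Hz'; lia.
    + intros y.
      set (D := dot d (inj y) b).
      (* The sign of [b d] decides which quotient is the left end of the interval, hence the
         [Rmin]. *)
      refine (at_most_preimage (fun z => z d) (fun c => set_at y d c) _ _ _ _
        (at_most_Z_interval (Rmin ((A - D) / b d) ((A + L - D) / b d)) _ _ Hk)).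
      intros z [[_ HA] Hy]; split; [|now rewrite <- Hy, set_at_set_at, set_at_id].
      assert (E : dot (Datatypes.S d) (inj z) b = D + IZR (z d) * b d).
      { unfold D, dot; simpl; f_equal; apply rsum_ext; intros j Hj.
        rewrite <- Hy; unfold inj; now rewrite set_at_other by lia. }
      rewrite E in HA.
      set (c := IZR (z d)) in *.
      destruct (Rlt_le_dec 0 (b d)) as [Hpos|Hneg].
      * rewrite Rabs_pos_eq by lra.
        assert (c = c * b d / b d) as -> by (field; lra).
        assert (Hd : forall u v, u <= v -> u / b d <= v / b d).
        { intros u v Huv; apply Rmult_le_compat_r; [|easy].
          left; now apply Rinv_0_lt_compat. }
        rewrite Rmin_left by (apply Hd; lra).
        replace ((A - D) / b d + L / b d) with ((A + L - D) / b d) by (field; lra).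
        split; apply Hd; lra.
      * rewrite Rabs_left by lra.
        assert (c = c * b d / b d) as -> by (field; lra).
        assert (Hd : forall u v, u <= v -> v / b d <= u / b d).
        { intros u v Huv; apply Rmult_le_compat_neg_l with (r := / b d) in Huv;
            [unfold Rdiv; lra|left; apply Rinv_lt_0_compat; lra]. }
        rewrite Rmin_right by (apply Hd; lra).
        replace ((A + L - D) / b d + L / - b d) with ((A - D) / b d) by (field; lra).
        split; apply Hd; lra.
    + apply lattice_box_at_most.
Qed.

(** * Cones *)

Lemma ncomb_plus U x y : ncomb U x -> ncomb U y -> ncomb U (fun i => x i + y i).
Proof.
  intros Hx Hy; induction Hy as [|y c u Hc Hu Hy IH].
  - replace (fun i => x i + 0) with x; [easy|].
    apply functional_extensionality; intros i; ring.
  - replace (fun i => x i + (y i + c * u i)) with (fun i => (x i + y i) + c * u i).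
    + now constructor.
    + apply functional_extensionality; intros i; ring.
Qed.

Lemma ncomb_scal U a x : 0 <= a -> ncomb U x -> ncomb U (fun i => a * x i).
Proof.
  intros Ha Hx; induction Hx as [|x c u Hc Hu Hx IH].
  - replace (fun _ : nat => a * 0) with (fun _ : nat => 0); [constructor|].
    apply functional_extensionality; intros i; ring.
  - replace (fun i => a * (x i + c * u i)) with (fun i => a * x i + (a * c) * u i).
    + constructor; auto; now apply Rmult_le_pos.
    + apply functional_extensionality; intros i; ring.
Qed.

Lemma ncomb_single U (u : nat -> R) : U u -> ncomb U u.
Proof.
  intros Hu; replace u with (fun i => 0 + 1 * u i).
  - apply ncombS; [lra|easy|constructor].
  - apply functional_extensionality; intros i; ring.
Qed.

Lemma ncomb_cone d U x : Rpt d x -> ncomb U x -> cone d U x.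
Proof.
  intros Hx Hn; split; [easy|]; intros eps Heps; exists x; split; [easy|].
  rewrite (rsum_ext d _ (fun _ => 0)); [rewrite rsum_const; lra|].
  intros i _; rewrite Rminus_diag; apply Rabs_R0.
Qed.

Lemma norm1_triang d u v : norm1 d (fun i => u i + v i) <= norm1 d u + norm1 d v.
Proof.
  unfold norm1; rewrite <- rsum_plus; apply rsum_le; intros; apply Rabs_triang.
Qed.

Lemma norm1_ext d u v : (forall i, (i < d)%nat -> u i = v i) -> norm1 d u = norm1 d v.
Proof. intros H; apply rsum_ext; intros i Hi; now rewrite H. Qed.

Lemma norm1_scal d a u : norm1 d (fun i => a * u i) = Rabs a * norm1 d u.
Proof.
  unfold norm1; rewrite <- rsum_scal; apply rsum_ext; intros; apply Rabs_mult.
Qed.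

Lemma norm1_le d u eta : (forall i, (i < d)%nat -> Rabs (u i) <= eta) ->
  norm1 d u <= INR d * eta.
Proof. intros H; rewrite <- rsum_const; now apply rsum_le. Qed.

Lemma cone_plus d U x y : cone d U x -> cone d U y -> cone d U (fun i => x i + y i).
Proof.
  intros [Rx Hx] [Ry Hy]; split; [intros i Hi; rewrite Rx, Ry by easy; ring|].
  intros eps Heps.
  destruct (Hx (eps / 2)) as (x' & Nx & Ex); [lra|].
  destruct (Hy (eps / 2)) as (y' & Ny & Ey); [lra|].
  exists (fun i => x' i + y' i); split; [now apply ncomb_plus|].
  eapply Rle_lt_trans; [|assert (H := Rplus_lt_compat _ _ _ _ Ex Ey);
    rewrite Rplus_half_diag in H; apply H].
  rewrite <- rsum_plus; apply rsum_le; intros i Hi.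
  replace (x i + y i - (x' i + y' i)) with ((x i - x' i) + (y i - y' i)) by ring.
  apply Rabs_triang.
Qed.

Lemma cone_scal d U a x : 0 <= a -> cone d U x -> cone d U (fun i => a * x i).
Proof.
  intros Ha [Rx Hx]; split; [intros i Hi; rewrite Rx by easy; ring|].
  intros eps Heps.
  destruct (Hx (eps / (a + 1))) as (x' & Nx & Ex); [apply Rdiv_lt_0_compat; lra|].
  exists (fun i => a * x' i); split; [now apply ncomb_scal|].
  apply Rmult_lt_compat_l with (r := a + 1) in Ex; [|lra].
  replace ((a + 1) * (eps / (a + 1))) with eps in Ex by (field; lra).
  eapply Rle_lt_trans; [|apply Ex].
  rewrite <- rsum_scal; apply rsum_le; intros i Hi.
  rewrite <- Rmult_minus_distr_l, Rabs_mult, (Rabs_pos_eq a) by easy.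
  apply Rmult_le_compat_r; [apply Rabs_pos|lra].
Qed.

Lemma cone_closed d U x : Rpt d x ->
  (forall eta, 0 < eta -> exists y, cone d U y /\
     forall i, (i < d)%nat -> Rabs (x i - y i) <= eta) ->
  cone d U x.
Proof.
  intros Rx H; split; [easy|]; intros eps Heps.
  pose proof (pos_INR d) as Hd.
  (* A coordinatewise error [eta] costs [d * eta] in the sum norm; [d + 1] keeps the denominator
     positive. *)
  assert (Heta : 0 < eps / 2 / (INR d + 1)) by (apply Rdiv_lt_0_compat; lra).
  destruct (H _ Heta) as (y & [_ Cy] & Hxy).
  destruct (Cy (eps / 2)) as (y' & Ny & Hy); [lra|].
  exists y'; split; [easy|].
  assert (H1 := norm1_le d (fun i => x i - y i) _ Hxy).
  assert (H2 := norm1_triang d (fun i => x i - y i) (fun i => y i - y' i)).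
  rewrite (norm1_ext d _ (fun i => x i - y' i)) in H2 by (intros; ring).
  assert (INR d * (eps / 2 / (INR d + 1)) <= eps / 2).
  { set (t := eps / 2 / (INR d + 1)) in *.
    assert (E : t * (INR d + 1) = eps / 2) by (unfold t; field; lra); nra. }
  unfold norm1 in *; lra.
Qed.

(* Compactness of the unit sphere of the cone, through bisection. *)
Theorem pointed_coercive d U b :
  pointing_vector d (cone d U) b ->
  exists delta, 0 < delta /\
    forall u, cone d U u -> delta * norm1 d u <= dot d u b.
Proof.
  intros Hb; apply NNPP; intros Hno.
  (* A violator of the bound is nonzero, since the zero vector satisfies it, and can be rescaled to
     norm 1. *)
  assert (H1 : forall delta, 0 < delta ->
    exists u, cone d U u /\ norm1 d u = 1 /\ dot d u b < delta).
  { intros delta Hdelta; apply NNPP; intros Hn; apply Hno.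
    exists delta; split; [easy|]; intros u Hu.
    apply Rnot_lt_le; intros Hlt; apply Hn.
    assert (Hpos : 0 < norm1 d u).
    { destruct (norm1_nonneg d u) as [H|H]; [easy|exfalso].
      assert (Habs : Rabs (dot d u b) <= 0 * norm1 d b).
      { apply dot_le; intros i Hi; rewrite H; now apply coord_le_norm1. }
      rewrite <- H, Rmult_0_r in Hlt; rewrite Rmult_0_l in Habs.
      pose proof (Rabs_pos_lt (dot d u b)); lra. }
    exists (fun i => / norm1 d u * u i); split; [|split].
    - apply cone_scal; [left; now apply Rinv_0_lt_compat|easy].
    - rewrite norm1_scal, Rabs_pos_eq by (left; now apply Rinv_0_lt_compat).
      field; lra.
    - rewrite dot_scal; apply Rmult_lt_reg_l with (norm1 d u); [easy|].
      rewrite <- Rmult_assoc, Rinv_r by lra; lra. }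
  set (P := fun lo hi => forall delta, 0 < delta ->
    exists u, cone d U u /\ norm1 d u = 1 /\ dot d u b < delta /\ in_box d lo hi u).
  destruct (bisection d P (fun _ => -1) (fun _ => 1)) as (x & Rx & Hx).
  - intros lo hi i Hi Hle HP; apply NNPP; intros [N1 N2]%not_or_and.
    apply not_all_ex_not in N1 as [d1 N1]; apply imply_to_and in N1 as [D1 N1].
    apply not_all_ex_not in N2 as [d2 N2]; apply imply_to_and in N2 as [D2 N2].
    (* The halves fail at [d1] and [d2]; a vector for the smaller threshold lies in one of them and
       refutes its failure. *)
    destruct (HP (Rmin d1 d2)) as (u & Cu & Nu & Du & Bu); [now apply Rmin_pos|].
    pose proof (Rmin_l d1 d2); pose proof (Rmin_r d1 d2).
    set (mid := (lo i + hi i) / 2) in *.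
    destruct (Rle_lt_dec (u i) mid) as [Hm|Hm].
    + apply N1; exists u; repeat (split; [easy || lra|]).
      intros j Hj; destruct (Nat.eq_dec j i) as [->|Hji].
      * rewrite set_at_same; split; [now apply Bu|easy].
      * rewrite set_at_other by easy; now apply Bu.
    + apply N2; exists u; repeat (split; [easy || lra|]).
      intros j Hj; destruct (Nat.eq_dec j i) as [->|Hji].
      * rewrite set_at_same; split; [lra|now apply Bu].
      * rewrite set_at_other by easy; now apply Bu.
  - intros; lra.
  - intros delta Hdelta; destruct (H1 delta Hdelta) as (u & Cu & Nu & Du).
    exists u; repeat (split; [easy|]); intros i Hi.
    pose proof (coord_le_norm1 d u i Hi) as H; rewrite Nu in H.
    apply Rabs_le_bounds in H; lra.
  - assert (Hclose : forall eta, 0 < eta -> exists u, cone d U u /\ norm1 d u = 1 /\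
      dot d u b < eta /\ forall i, (i < d)%nat -> Rabs (x i - u i) <= eta).
    { intros eta Heta; destruct (Hx eta Heta) as (lo & hi & HP & Bx & Hsub).
      destruct (HP eta Heta) as (u & Cu & Nu & Du & Bu).
      exists u; repeat (split; [easy|]); intros i Hi.
      specialize (Bx i Hi); specialize (Bu i Hi); specialize (Hsub i Hi).
      apply Rabs_le; lra. }
    assert (Cx : cone d U x).
    { apply cone_closed; [easy|]; intros eta Heta.
      destruct (Hclose eta Heta) as (u & Cu & _ & _ & Hu); now exists u. }
    assert (Hxnz : exists i, (i < d)%nat /\ x i <> 0).
    { apply NNPP; intros Hz.
      pose proof (pos_INR d) as Hd.
      (* If [x] vanished, a unit vector this close to it would have norm at most [d / (d + 1)]. *)
      destruct (Hclose (/ (INR d + 1))) as (u & _ & Nu & _ & Hu).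
      { apply Rinv_0_lt_compat; lra. }
      assert (norm1 d u <= INR d * / (INR d + 1)).
      { apply norm1_le; intros i Hi.
        replace (u i) with (- (x i - u i)); [rewrite Rabs_Ropp; auto|].
        replace (x i) with 0; [ring|].
        apply NNPP; intros Hi0; apply Hz; exists i; auto. }
      assert (INR d * / (INR d + 1) = 1 - / (INR d + 1)) by (field; lra).
      assert (0 < / (INR d + 1)) by (apply Rinv_0_lt_compat; lra); lra. }
    specialize (Hb x Cx Hxnz).
    pose proof (norm1_nonneg d b) as Hnb.
    (* The pairings of [x] and [u] differ by at most [dot d x b / 2 - eta] while that of [u] is
       below [eta], so [dot d x b] would be less than its half. *)
    set (eta := dot d x b / 2 / (norm1 d b + 1)).
    assert (Heta : 0 < eta) by (apply Rdiv_lt_0_compat; lra).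
    destruct (Hclose eta Heta) as (u & _ & _ & Du & Hu).
    assert (Hdot := dot_le d (fun i => x i - u i) b eta Hu).
    assert (E : dot d (fun i => x i - u i) b = dot d x b - dot d u b).
    { unfold Rminus at 1; rewrite (dot_ext d _ (fun i => x i + (-1) * u i))
        by (intros; ring).
      rewrite dot_plus, dot_scal; ring. }
    rewrite E in Hdot; apply Rabs_le_bounds in Hdot.
    assert (eta * (norm1 d b + 1) = dot d x b / 2) by (unfold eta; field; lra).
    lra.
Qed.

(** * Semigroups *)

Lemma semigroup_scal d Sg k s :
  is_semigroup d Sg -> (0 <= k)%Z -> Sg s -> Sg (fun i => (k * s i)%Z).
Proof.
  intros (_ & H0 & Hadd) Hk Hs.
  rewrite <- (Z2Nat.id k) by easy; induction (Z.to_nat k) as [|n IH].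
  - exact H0.
  - replace (fun i => (Z.of_nat (Datatypes.S n) * s i)%Z)
      with (zadd (fun i => (Z.of_nat n * s i)%Z) s); [now apply Hadd|].
    apply functional_extensionality; intros i; unfold zadd; lia.
Qed.

(** Lattice version of an interior point of the cone: after division by [n], the unit cube around
    [s0] is filled ever more finely by scaled elements of the semigroup. *)
Definition deep_point (d : nat) (Sg : (nat -> Z) -> Prop) (s0 : nat -> Z) : Prop :=
  Sg s0 /\ forall n v, Zpt d v ->
    (forall i, (i < d)%nat -> (Z.abs (v i) <= n)%Z) -> (0 <= n)%Z ->
    Sg (fun i => (n * s0 i + v i)%Z).

(* With [e_j = a_j - a'_j] and [a_j, a'_j] in [S], take [s0] to be the sum of all
   [a_j + a'_j]: then [n s0 + v] is the sum of the [(n + v_j) a_j + (n - v_j) a'_j]. *)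
Lemma standard_deep_point d Sg :
  standard d Sg -> exists s0, deep_point d Sg s0.
Proof.
  intros (HS & Hdiff & _); assert (H := HS); destruct H as (Hpt & H0 & Hadd).
  enough (H : forall k, (k <= d)%nat -> exists s0, Sg s0 /\ forall n v, Zpt k v ->
    (forall i, (i < k)%nat -> (Z.abs (v i) <= n)%Z) -> (0 <= n)%Z ->
    Sg (fun i => (n * s0 i + v i)%Z)) by now apply (H d).
  induction k as [|k IH]; intros Hk.
  - exists (fun _ => 0%Z); split; [easy|]; intros n v Hv _ _.
    replace (fun i => (n * 0 + v i)%Z) with (fun _ : nat => 0%Z); [easy|].
    apply functional_extensionality; intros i; rewrite Hv by lia; ring.
  - destruct IH as (s0 & Hs0 & Hdeep); [lia|].
    destruct (Hdiff (set_at (fun _ => 0%Z) k 1%Z)) as (a & a' & Ha & Ha' & E).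
    { intros i Hi; now rewrite set_at_other by lia. }
    exists (zadd s0 (zadd a a')); split; [auto|]; intros n v Hv Hvn Hn.
    replace (fun i => (n * zadd s0 (zadd a a') i + v i)%Z) with
      (zadd (fun i => (n * s0 i + set_at v k 0%Z i)%Z)
        (zadd (fun i => ((n + v k) * a i)%Z) (fun i => ((n - v k) * a' i)%Z))).
    + specialize (Hvn k (le_n _)) as Hvk.
      apply Hadd; [|apply Hadd; (apply (semigroup_scal d); [easy|lia|easy])].
      apply Hdeep; [now apply set_at_Zpt| |easy].
      intros i Hi; rewrite set_at_other by lia; apply Hvn; lia.
    + apply functional_extensionality; intros i; unfold zadd.
      apply (f_equal (fun f => f i)) in E; unfold zsub in E.
      destruct (Nat.eq_dec i k) as [->|Hik];
        [rewrite !set_at_same in *; nia|rewrite !set_at_other in * by easy; nia].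
Qed.

Lemma ncomb_semigroup (Sg : (nat -> Z) -> Prop) s c : Sg s -> 0 <= c ->
  ncomb (fun x => exists s, Sg s /\ x = inj s) (fun i => c * inj s i).
Proof.
  intros Hs Hc; apply ncomb_scal; [easy|]; apply ncomb_single; now exists s.
Qed.

Lemma Scone_semigroup d Sg s c :
  is_semigroup d Sg -> Sg s -> 0 <= c -> Scone d Sg (fun i => c * inj s i).
Proof.
  intros (Hpt & _) Hs Hc; apply ncomb_cone; [|now apply ncomb_semigroup].
  intros i Hi; unfold inj; rewrite (Hpt s Hs i Hi); ring.
Qed.

(** Rounding [n * xi / r] down gives [v] with entries at most [n] in absolute value, so [n * s0 + v]
    is in the semigroup. Scaled by [r / n] it is within [r / n] of the target, and the cone is
    closed. *)
Lemma deep_point_Scone d Sg s0 r xi :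
  is_semigroup d Sg -> deep_point d Sg s0 -> 0 < r ->
  Rpt d xi -> (forall i, (i < d)%nat -> Rabs (xi i) <= r) ->
  Scone d Sg (fun i => r * inj s0 i + xi i).
Proof.
  intros HS [Hs0 Hdeep] Hr Rxi Hxi; apply cone_closed.
  - intros i Hi; destruct HS as (Hpt & _); unfold inj.
    rewrite (Hpt s0 Hs0 i Hi), (Rxi i Hi); ring.
  - intros eta Heta; destruct (nat_above (r / eta)) as (n & Hn0 & Hn).
    assert (Hnpos : 0 < INR n) by now apply lt_0_INR.
    assert (Hv : forall i, exists v : Z, ((d <= i)%nat -> v = 0%Z) /\
      ((i < d)%nat -> IZR v <= INR n * xi i / r < IZR v + 1)).
    { intros i; destruct (le_lt_dec d i) as [Hi|Hi].
      - exists 0%Z; split; [easy|lia].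
      - destruct (floor_exists (INR n * xi i / r)) as [v Hv]; exists v; split; [lia|easy]. }
    apply choice in Hv as [v Hv].
    exists (fun i => r / INR n * inj (fun j => (Z.of_nat n * s0 j + v j)%Z) i); split.
    + apply Scone_semigroup; [easy| |left; now apply Rdiv_lt_0_compat].
      apply Hdeep; [intros i; apply Hv| |lia].
      intros i Hi; destruct (Hv i) as [_ Hvi]; specialize (Hvi Hi).
      specialize (Hxi i Hi); apply Rabs_le_bounds in Hxi.
      assert (B : - INR n <= INR n * xi i / r <= INR n).
      { split; apply Rmult_le_reg_r with r; try easy; unfold Rdiv;
          rewrite ?Rmult_assoc, Rinv_l, ?Rmult_1_r by lra; nra. }
      rewrite INR_IZR_INZ in B, Hvi.
      assert (v i <= Z.of_nat n)%Z by (apply le_IZR; lra).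
      assert (- Z.of_nat n < v i + 1)%Z; [|lia].
      apply lt_IZR; rewrite plus_IZR, opp_IZR; lra.
    + intros i Hi; destruct (Hv i) as [_ Hvi]; specialize (Hvi Hi).
      unfold inj; rewrite plus_IZR, mult_IZR, <- INR_IZR_INZ.
      replace (r * IZR (s0 i) + xi i - r / INR n * (INR n * IZR (s0 i) + IZR (v i)))
        with (r / INR n * (INR n * xi i / r - IZR (v i))) by (field; lra).
      assert (r / INR n <= eta).
      { apply Rmult_lt_compat_r with (r := eta) in Hn; [|easy].
        unfold Rdiv in Hn; rewrite Rmult_assoc, Rinv_l in Hn by lra.
        apply Rmult_le_reg_r with (INR n); [easy|].
        unfold Rdiv; rewrite Rmult_assoc, Rinv_l by lra; lra. }
      assert (0 < r / INR n) by now apply Rdiv_lt_0_compat.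
      rewrite Rabs_pos_eq by (apply Rmult_le_pos; lra).
      nra.
Qed.

(** Rounding a coefficient [q * c] down costs less than one copy of its generator. [M] sums the
    norms of the generators, whatever [q] is. *)
Lemma ncomb_floor d Sg y :
  is_semigroup d Sg -> ncomb (fun x => exists s, Sg s /\ x = inj s) y ->
  exists M, 0 <= M /\ forall q, 0 <= q -> exists s, Sg s /\
    forall i, (i < d)%nat -> Rabs (q * y i - inj s i) <= M.
Proof.
  intros HS Hy; assert (H := HS); destruct H as (_ & H0 & Hadd).
  induction Hy as [|y c u Hc [t [Ht ->]] Hy (M & HM & IH)].
  - exists 0; split; [lra|]; intros q Hq; exists (fun _ => 0%Z); split; [easy|].
    intros i _; unfold inj; rewrite Rmult_0_r, Rminus_diag, Rabs_R0; lra.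
  - exists (M + norm1 d (inj t)); pose proof (norm1_nonneg d (inj t)).
    split; [lra|]; intros q Hq; destruct (IH q Hq) as (s & Hs & Hqs).
    destruct (floor_exists (q * c)) as [k Hk].
    assert (0 <= q * c) by now apply Rmult_le_pos.
    assert (0 <= k)%Z.
    { assert (-1 < k)%Z; [apply lt_IZR|]; simpl; try lia; lra. }
    exists (zadd s (fun i => (k * t i)%Z)); split.
    + apply Hadd; [easy|]; now apply (semigroup_scal d).
    + intros i Hi; specialize (Hqs i Hi).
      assert (Hti := coord_le_norm1 d (inj t) i Hi).
      unfold inj in *; unfold zadd; rewrite plus_IZR, mult_IZR.
      replace (q * (y i + c * IZR (t i)) - (IZR (s i) + IZR k * IZR (t i)))
        with ((q * y i - IZR (s i)) + (q * c - IZR k) * IZR (t i)) by ring.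
      eapply Rle_trans; [apply Rabs_triang|]; apply Rplus_le_compat; [easy|].
      rewrite Rabs_mult, (Rabs_pos_eq (q * c - IZR k)) by lra.
      pose proof (Rabs_pos (IZR (t i))); nra.
Qed.

(* Plays the role of the conductor of the semigroup. *)
Lemma lattice_points_deep_in_cone d Sg s0 c r :
  is_semigroup d Sg -> deep_point d Sg s0 -> Scone d Sg c -> 0 < r ->
  exists q0 : R, forall q u, q0 <= q -> 0 <= q -> Zpt d u ->
    (forall i, (i < d)%nat ->
       Rabs (inj u i - q * (c i + 3 * r * inj s0 i)) <= q * r) ->
    Sg u.
Proof.
  intros HS [Hs0 Hdeep] [_ Hc] Hr; assert (H := HS); destruct H as (Hpt & _ & Hadd).
  destruct (Hc r Hr) as (y & Hy & Hcy).
  destruct (ncomb_floor d Sg y HS Hy) as (M & HM & Hfloor).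
  pose proof (norm1_nonneg d (inj s0)) as Hn0.
  (* Origin of the factor 3: one [q * r] pays for the distance of [u] from its centre, one for
     replacing [c] by [y], and one for the roundings, namely [M], the fraction of [s0] lost in [n],
     and 1 since [n] is only a floor. *)
  exists ((M + norm1 d (inj s0) + 1) / r); intros q u Hq Hq0 Hu Hclose.
  assert (Hqr : M + norm1 d (inj s0) + 1 <= q * r).
  { apply Rmult_le_compat_r with (r := r) in Hq; [|lra].
    unfold Rdiv in Hq; rewrite Rmult_assoc, Rinv_l in Hq; lra. }
  destruct (Hfloor q Hq0) as (s & Hs & Hqs).
  destruct (floor_exists (3 * (q * r))) as [n Hn].
  assert (0 <= n)%Z.
  { assert (-1 < n)%Z; [apply lt_IZR|]; simpl; try lia; lra. }
  replace u with (zadd s (fun i => (n * s0 i + (u i - s i - n * s0 i))%Z)).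
  2: { apply functional_extensionality; intros i; unfold zadd; ring. }
  apply Hadd; [easy|]; apply Hdeep; [| |easy].
  - intros i Hi; rewrite (Hu i Hi), (Hpt s Hs i Hi), (Hpt s0 Hs0 i Hi); ring.
  - intros i Hi; specialize (Hclose i Hi); specialize (Hqs i Hi).
    assert (Hci := coord_le_norm1 d (fun j => c j - y j) i Hi).
    assert (Hsi := coord_le_norm1 d (inj s0) i Hi).
    unfold norm1 at 1 in Hci; simpl in Hci.
    apply le_IZR; rewrite abs_IZR, !minus_IZR, mult_IZR.
    fold (inj u i) (inj s i) (inj s0 i).
    replace (inj u i - inj s i - IZR n * inj s0 i)
      with ((inj u i - q * (c i + 3 * r * inj s0 i)) + q * (c i - y i)
        + (q * y i - inj s i) + (3 * (q * r) - IZR n) * inj s0 i) by ring.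
    assert (T1 : Rabs (q * (c i - y i)) <= q * r).
    { rewrite Rabs_mult, (Rabs_pos_eq q) by easy; apply Rmult_le_compat_l; lra. }
    assert (T2 : Rabs ((3 * (q * r) - IZR n) * inj s0 i) <= norm1 d (inj s0)).
    { rewrite Rabs_mult, (Rabs_pos_eq (_ - _)) by lra.
      pose proof (Rabs_pos (inj s0 i)); nra. }
    eapply Rle_trans; [apply Rabs_triang|].
    eapply Rle_trans; [apply Rplus_le_compat_r, Rabs_triang|].
    eapply Rle_trans; [apply Rplus_le_compat_r, Rplus_le_compat_r, Rabs_triang|].
    lra.
Qed.

(** * Grid cells and the truncated p-body *)

(** Half-open, so that rounding down assigns each point its cell; the closed version below matches
    the closed boxes of covers. *)
Definition cell (d m : nat) (z : nat -> Z) (x : nat -> R) : Prop :=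
  forall i, (i < d)%nat -> IZR (z i) <= INR m * x i < IZR (z i) + 1.

Definition closed_cell (d m : nat) (z : nat -> Z) (x : nat -> R) : Prop :=
  forall i, (i < d)%nat -> IZR (z i) <= INR m * x i <= IZR (z i) + 1.

Lemma cell_closed_cell d m z x : cell d m z x -> closed_cell d m z x.
Proof. intros H i Hi; specialize (H i Hi); lra. Qed.

Lemma closed_cell_box d m z x : (0 < m)%nat ->
  closed_cell d m z x <->
  in_box d (fun i => IZR (z i) / INR m) (fun i => (IZR (z i) + 1) / INR m) x.
Proof.
  intros Hm%lt_0_INR.
  assert (E : forall r, r / INR m * INR m = r) by (intros; field; lra).
  split; intros H i Hi; specialize (H i Hi).
  - split; apply Rmult_le_reg_r with (INR m); try easy; rewrite E; lra.
  - destruct H as [H1 H2]; apply Rmult_le_compat_r with (r := INR m) in H1, H2;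
      try lra; rewrite E in H1, H2; lra.
Qed.

Definition shift3 (s0 z : nat -> Z) : nat -> Z := fun i => (z i + 3 * s0 i)%Z.

(** [m * x] and [m * y - 3 * s0] lie in the same closed unit cube. *)
Lemma shifted_cell_close d m s0 z x y : (0 < m)%nat ->
  closed_cell d m z x -> closed_cell d m (shift3 s0 z) y ->
  forall i, (i < d)%nat -> Rabs (y i - x i - 3 * / INR m * inj s0 i) <= / INR m.
Proof.
  intros Hm%lt_0_INR Hx Hy i Hi; specialize (Hx i Hi); specialize (Hy i Hi).
  unfold shift3 in Hy; rewrite plus_IZR, mult_IZR in Hy.
  replace (y i - x i - 3 * / INR m * inj s0 i)
    with (/ INR m * (INR m * y i - INR m * x i - 3 * IZR (s0 i)))
    by (unfold inj; field; lra).
  assert (0 < / INR m) by now apply Rinv_0_lt_compat.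
  rewrite Rabs_mult, (Rabs_pos_eq (/ INR m)) by lra.
  rewrite <- (Rmult_1_r (/ INR m)) at 2; apply Rmult_le_compat_l; [lra|].
  apply Rabs_le; lra.
Qed.

Definition truncated_body d p Sg T b alpha (x : nat -> R) : Prop :=
  p_body d p Sg T x /\ dot d x b < alpha.

Lemma INR_pow_pos p e : (1 < p)%nat -> 0 < INR (p ^ e).
Proof. intros Hp; apply lt_0_INR; assert (p ^ e <> 0)%nat; [apply Nat.pow_nonzero|]; lia. Qed.

Lemma p_system_scal p Sg T e k t :
  p_system p Sg T -> T e t -> T (e + k)%nat (fun i => (Z.of_nat (p ^ k) * t i)%Z).
Proof.
  intros [_ Hp] Ht; induction k as [|k IH].
  - rewrite Nat.add_0_r; replace (fun i => (Z.of_nat (p ^ 0) * t i)%Z) with t; [easy|].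
    apply functional_extensionality; intros i; simpl Nat.pow; lia.
  - apply Hp in IH; replace (e + Datatypes.S k)%nat with (e + k + 1)%nat by lia.
    replace (fun i => (Z.of_nat (p ^ Datatypes.S k) * t i)%Z)
      with (fun i => (Z.of_nat p * (Z.of_nat (p ^ k) * t i))%Z); [easy|].
    apply functional_extensionality; intros i.
    rewrite Nat.pow_succ_r', Nat2Z.inj_mul; ring.
Qed.

Lemma p_body_Scone d p Sg T x :
  (1 < p)%nat -> is_semigroup d Sg -> p_system p Sg T ->
  p_body d p Sg T x -> Scone d Sg x.
Proof.
  intros Hp HS [Hid _] (e & t & c & Ht & Hc & ->).
  pose proof (INR_pow_pos p e Hp).
  replace (fun i => inj t i / INR (p ^ e) + c i)
    with (fun i => / INR (p ^ e) * inj t i + c i)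
    by (apply functional_extensionality; intros i; unfold Rdiv; ring).
  apply cone_plus; [|easy].
  apply Scone_semigroup; [easy|now apply (Hid e)|].
  left; now apply Rinv_0_lt_compat.
Qed.

Lemma lattice_point_p_body d p Sg T e z :
  T e z -> p_body d p Sg T (fun i => inj z i / INR (p ^ e)).
Proof.
  intros Hz; exists e, z, (fun _ => 0); split; [easy|split].
  - apply ncomb_cone; [easy|constructor].
  - apply functional_extensionality; intros i; ring.
Qed.

Lemma dot_lattice_point d p b e z alpha : (1 < p)%nat ->
  dot d (fun i => inj z i / INR (p ^ e)) b < alpha
    <-> dot d (inj z) b < INR (p ^ e) * alpha.
Proof.
  intros Hp; pose proof (INR_pow_pos p e Hp) as Hq.
  rewrite (dot_ext d _ (fun i => / INR (p ^ e) * inj z i))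
    by (intros; unfold Rdiv; ring).
  rewrite dot_scal; set (D := dot d (inj z) b); set (q := INR (p ^ e)) in *.
  split; intros H.
  - apply Rmult_lt_compat_l with (r := q) in H; [|easy].
    rewrite <- Rmult_assoc, Rinv_r in H; lra.
  - apply Rmult_lt_reg_l with q; [easy|]; rewrite <- Rmult_assoc, Rinv_r; lra.
Qed.

Lemma truncated_body_bounded d p Sg T b alpha :
  (1 < p)%nat -> is_semigroup d Sg -> p_system p Sg T ->
  pointing_vector d (Scone d Sg) b ->
  exists r : nat, (0 < r)%nat /\ forall x, truncated_body d p Sg T b alpha x ->
    forall i, (i < d)%nat -> Rabs (x i) < INR r.
Proof.
  intros Hp HS HT (delta & Hdelta & Hcoer)%pointed_coercive.
  destruct (nat_above (alpha / delta)) as (r & Hr0 & Hr); exists r; split; [easy|].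
  intros x [Hx Hdot] i Hi.
  specialize (Hcoer x (p_body_Scone d p Sg T x Hp HS HT Hx)).
  assert (Hxi := coord_le_norm1 d x i Hi).
  apply Rmult_lt_compat_r with (r := delta) in Hr; [|easy].
  unfold Rdiv in Hr; rewrite Rmult_assoc, Rinv_l in Hr by lra.
  apply Rmult_lt_reg_r with delta; [easy|]; nra.
Qed.

(** The displacement [y - x] is [3 / m] times [s0] plus a vector with entries at most [1 / m], hence
    in the cone. It is absorbed by [c], while [t] stays. *)
Lemma p_body_shifted_cell d p Sg T s0 m z x y :
  is_semigroup d Sg -> deep_point d Sg s0 -> (0 < m)%nat ->
  p_body d p Sg T x -> Rpt d x -> closed_cell d m z x ->
  Rpt d y -> closed_cell d m (shift3 s0 z) y ->
  p_body d p Sg T y.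
Proof.
  intros HS Hs0 Hm (e & t & c & Ht & Hc & Ex) Rx Hx Ry Hy.
  assert (Hclose := shifted_cell_close d m s0 z x y Hm Hx Hy).
  apply lt_0_INR in Hm; assert (0 < / INR m) by now apply Rinv_0_lt_compat.
  exists e, t, (fun i => c i + (3 * / INR m * inj s0 i
    + (y i - x i - 3 * / INR m * inj s0 i))); split; [easy|split].
  - apply cone_plus; [easy|]; apply deep_point_Scone; try easy; [lra| |].
    + intros i Hi; destruct HS as [Hpt _], Hs0 as [Hs0 _].
      unfold inj; rewrite (Hpt s0 Hs0 i Hi), Rx, Ry by easy; ring.
    + intros i Hi; specialize (Hclose i Hi); lra.
  - apply functional_extensionality; intros i; rewrite Ex; ring.
Qed.

(** At [q = p^e0 * p^k] the p-system carries [t] to [p^k * t]. The difference [y - p^k * t] is close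
    to [q * (c + 3 * s0 / m)], hence in the semigroup, and the ideal absorbs it. *)
Lemma p_system_shifted_cell d p Sg T s0 m z x :
  (1 < p)%nat -> is_semigroup d Sg -> p_system p Sg T -> deep_point d Sg s0 ->
  (0 < m)%nat -> p_body d p Sg T x -> closed_cell d m z x ->
  exists e0, forall e y, (e0 <= e)%nat -> Zpt d y ->
    closed_cell d m (shift3 s0 z) (fun i => inj y i / INR (p ^ e)) -> T e y.
Proof.
  intros Hp HS HT Hs0 Hm (e0 & t & c & Ht & Hc & Ex) Hx.
  assert (Hmr := lt_0_INR m Hm).
  assert (Hmi : 0 < / INR m) by now apply Rinv_0_lt_compat.
  destruct (lattice_points_deep_in_cone d Sg s0 c (/ INR m) HS Hs0 Hc Hmi) as [q0 Hq0].
  destruct (nat_above q0) as (n0 & _ & Hn0).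
  (* The part [e0] makes [p^e0] divide [q]; the part [n0] makes [q] exceed [q0], because
     [p^e > e]. *)
  exists (e0 + n0)%nat; intros e y He Hy Hcell.
  assert (Hclose := shifted_cell_close d m s0 z x _ Hm Hx Hcell).
  set (k := (e - e0)%nat); replace e with (e0 + k)%nat in * by lia.
  assert (Eq : INR (p ^ (e0 + k)) = INR (p ^ e0) * INR (p ^ k))
    by now rewrite Nat.pow_add_r, mult_INR.
  pose proof (INR_pow_pos p e0 Hp); pose proof (INR_pow_pos p k Hp).
  set (q := INR (p ^ (e0 + k))) in *.
  assert (Hqpos : 0 < q) by (rewrite Eq; nra).
  assert (Hq : q0 <= q).
  { assert (Hlin := Nat.pow_gt_lin_r p (e0 + k) Hp).
    assert (INR n0 <= q) by (apply le_INR; lia); lra. }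
  set (u := fun i => (y i - Z.of_nat (p ^ k) * t i)%Z).
  assert (HtS : Sg t) by now apply (proj1 HT e0).
  assert (Hpt := proj1 HS).
  replace y with (zadd u (fun i => (Z.of_nat (p ^ k) * t i)%Z)).
  2: { apply functional_extensionality; intros i; unfold zadd, u; ring. }
  apply (proj1 HT (e0 + k)%nat); [|now apply (p_system_scal p Sg)].
  apply (Hq0 q); [easy|lra| |].
  - intros i Hi; unfold u; rewrite Hy, (Hpt t HtS i Hi) by easy; ring.
  - intros i Hi; specialize (Hclose i Hi).
    replace (inj u i - q * (c i + 3 * / INR m * inj s0 i))
      with (q * (inj y i / q - x i - 3 * / INR m * inj s0 i)).
    + rewrite Rabs_mult, (Rabs_pos_eq q) by lra; apply Rmult_le_compat_l; lra.
    + rewrite Ex; unfold u, inj; rewrite minus_IZR, mult_IZR, <- INR_IZR_INZ, Eq.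
      field; lra.
Qed.

(** * Outer and inner cells *)

Definition outer_cell d p Sg T b alpha m (z : nat -> Z) : Prop :=
  Zpt d z /\ exists x, Rpt d x /\ cell d m z x /\ truncated_body d p Sg T b alpha x.

(** The threshold [e0] may depend on the cell; a common one exists because inner cells are finitely
    many. *)
Definition inner_cell d p Sg T b alpha m (z : nat -> Z) : Prop :=
  Zpt d z /\
  (forall x, Rpt d x -> closed_cell d m z x -> truncated_body d p Sg T b alpha x) /\
  exists e0, forall e y, (e0 <= e)%nat -> Zpt d y ->
    closed_cell d m z (fun i => inj y i / INR (p ^ e)) -> T e y.

(** Only the hyperplane is mentioned, so these cells are counted without reference to the p-body. *)
Definition crossing_cell d b alpha s0 m (z : nat -> Z) : Prop :=
  exists x y, cell d m z x /\ closed_cell d m (shift3 s0 z) y /\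
    dot d x b < alpha <= dot d y b.

Lemma outer_cell_cases d p Sg T b alpha s0 m z :
  (1 < p)%nat -> is_semigroup d Sg -> p_system p Sg T -> deep_point d Sg s0 ->
  (0 < m)%nat -> outer_cell d p Sg T b alpha m z ->
  inner_cell d p Sg T b alpha m (shift3 s0 z) \/ crossing_cell d b alpha s0 m z.
Proof.
  intros Hp HS HT Hs0 Hm (Hz & x & Rx & Hx & Bx & Dx).
  destruct (classic (exists y, closed_cell d m (shift3 s0 z) y /\ alpha <= dot d y b))
    as [(y & Hy & Dy)|Hno]; [right; now exists x, y|left].
  split; [|split].
  - intros i Hi; unfold shift3; destruct HS as [Hpt _].
    rewrite Hz, (Hpt s0 (proj1 Hs0) i Hi) by easy; ring.
  - intros y Ry Hy; split.
    + apply cell_closed_cell in Hx; now apply (p_body_shifted_cell d p Sg T s0 m z x y).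
    + apply Rnot_le_lt; intros Dy; apply Hno; now exists y.
  - apply cell_closed_cell in Hx; now apply (p_system_shifted_cell d p Sg T s0 m z x).
Qed.

Lemma cell_corner d m (z : nat -> Z) : (0 < m)%nat ->
  cell d m z (fun i => inj z i / INR m).
Proof.
  intros Hm%lt_0_INR i Hi; unfold inj.
  replace (INR m * (IZR (z i) / INR m)) with (IZR (z i)) by (field; lra); lra.
Qed.

Lemma cell_centered d m r z x :
  Zpt d z -> cell d m z x -> (0 < m)%nat ->
  (forall i, (i < d)%nat -> Rabs (x i) < INR r) ->
  centered_box d (r * m) z.
Proof.
  intros Hz Hx Hm%lt_0_INR Hr; split; [easy|]; intros i Hi.
  specialize (Hx i Hi); specialize (Hr i Hi); apply Rabs_def2 in Hr.
  assert (H : - (INR r * INR m) < INR m * x i < INR r * INR m) by nra.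
  rewrite <- mult_INR, INR_IZR_INZ in H; set (n := (r * m)%nat) in *.
  assert (z i < Z.of_nat n)%Z by (apply lt_IZR; lra).
  assert (- Z.of_nat n < z i + 1)%Z; [|lia].
  apply lt_IZR; rewrite plus_IZR, opp_IZR; lra.
Qed.

Lemma closed_cell_dot d m z x b : closed_cell d m z x ->
  Rabs (INR m * dot d x b - dot d (inj z) b) <= norm1 d b.
Proof.
  intros Hx.
  replace (INR m * dot d x b - dot d (inj z) b)
    with (dot d (fun i => INR m * x i + (-1) * inj z i) b)
    by (rewrite dot_plus, !dot_scal; ring).
  rewrite <- (Rmult_1_l (norm1 d b)); apply dot_le; intros i Hi.
  specialize (Hx i Hi); unfold inj; apply Rabs_le; lra.
Qed.

Lemma dot_zero d x b : (forall i, (i < d)%nat -> b i = 0) -> dot d x b = 0.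
Proof.
  intros Hb; unfold dot; rewrite (rsum_ext d _ (fun _ => 0)), rsum_const; [ring|].
  intros i Hi; rewrite Hb by easy; ring.
Qed.

(** The corner of such a cell lies in a slab whose width does not depend on [m]. Bounding [n * m]
    avoids the exponent [d - 1] and directly gives the proportion [C / m]. *)
Lemma crossing_cells_negligible d b alpha s0 r :
  exists C, 0 <= C /\ forall m, (0 < m)%nat -> exists n,
    at_most (fun z => centered_box d (r * m) z /\ crossing_cell d b alpha s0 m z) n /\
    INR n * INR m <= C * INR m ^ d.
Proof.
  destruct (classic (exists i, (i < d)%nat /\ b i <> 0)) as [(i & Hi & Hbi)|Hb].
  (* The first term comes from the translation; each of the two cells adds one [norm1 d b], since
     its scaled points differ from the corner by at most 1 per coordinate. *)
  - set (L := 3 * dot d (inj s0) b + 2 * norm1 d b).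
    destruct (slab_at_most d b L i Hi Hbi) as [K HK].
    exists ((2 * INR r) ^ (d - 1) * INR K); split.
    { apply Rmult_le_pos; [apply pow_le|]; pose proof (pos_INR r); [lra|apply pos_INR]. }
    intros m Hm; exists ((2 * (r * m)) ^ (d - 1) * K)%nat; split.
    + eapply at_most_incl; [|apply (HK (r * m)%nat
        (INR m * alpha - 3 * dot d (inj s0) b - norm1 d b))].
      intros z [Hz (x & y & Hx & Hy & Dx & Dy)]; split; [easy|].
      apply cell_closed_cell, (closed_cell_dot d m z x b), Rabs_le_bounds in Hx.
      apply (closed_cell_dot d m _ y b), Rabs_le_bounds in Hy.
      assert (E : dot d (inj (shift3 s0 z)) b = dot d (inj z) b + 3 * dot d (inj s0) b).
      { rewrite <- dot_scal, <- dot_plus; apply dot_ext; intros j _.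
        unfold inj, shift3; rewrite plus_IZR, mult_IZR; ring. }
      rewrite E in Hy; apply lt_0_INR in Hm.
      assert (INR m * dot d x b < INR m * alpha) by (apply Rmult_lt_compat_l; easy).
      assert (INR m * alpha <= INR m * dot d y b) by (apply Rmult_le_compat_l; lra).
      unfold L; lra.
    + rewrite mult_INR, pow_INR, !mult_INR; simpl (INR 2).
      replace ((1 + 1) * (INR r * INR m)) with ((2 * INR r) * INR m) by ring.
      rewrite Rpow_mult_distr; right.
      replace d with (Datatypes.S (d - 1)) at 4 by lia; simpl pow; ring.
  - exists 0; split; [lra|]; intros m Hm; exists O; split; [|simpl; lra].
    assert (Hb0 : forall i, (i < d)%nat -> b i = 0).
    { intros i Hi; apply NNPP; intros H; apply Hb; now exists i. }
    (* When [b] vanishes both pairings are 0 and cannot be separated by [alpha]. *)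
    exists nil; split; [|easy]; intros z [_ (x & y & _ & _ & Dx & Dy)].
    rewrite dot_zero in Dx, Dy by easy; lra.
Qed.

Lemma outer_cells_card d p Sg T b alpha r m :
  (0 < m)%nat ->
  (forall x, truncated_body d p Sg T b alpha x ->
     forall i, (i < d)%nat -> Rabs (x i) < INR r) ->
  exists n, has_card (outer_cell d p Sg T b alpha m) n.
Proof.
  intros Hm Hr.
  destruct (at_most_card (outer_cell d p Sg T b alpha m) ((2 * (r * m)) ^ d)) as (n & Hn & _).
  - eapply at_most_incl; [|apply lattice_box_at_most].
    intros z (Hz & x & _ & Hx & Bx); apply (cell_centered d m r z x); auto.
  - now exists n.
Qed.

Lemma inner_cell_outer_cell d p Sg T b alpha m z : (0 < m)%nat ->
  inner_cell d p Sg T b alpha m z -> outer_cell d p Sg T b alpha m z.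
Proof.
  intros Hm (Hz & Hin & _); split; [easy|].
  assert (Hc := cell_corner d m z Hm).
  assert (Rpt d (fun i => inj z i / INR m)).
  { intros i Hi; unfold inj; rewrite Hz by easy; unfold Rdiv; ring. }
  exists (fun i => inj z i / INR m); split; [easy|split; [easy|]].
  apply Hin; [easy|now apply cell_closed_cell].
Qed.

Lemma uniform_threshold {A} (Q : A -> nat -> Prop) (l : list A) :
  (forall z, In z l -> exists e0, forall e, (e0 <= e)%nat -> Q z e) ->
  exists e0, forall z e, In z l -> (e0 <= e)%nat -> Q z e.
Proof.
  induction l as [|z l IH]; intros H.
  - exists O; easy.
  - destruct IH as [e1 H1]; [intros; apply H; now right|].
    destruct (H z) as [e2 H2]; [now left|].
    exists (e1 + e2)%nat; intros z' e [<-|Hz'] He; [apply H2|apply H1]; auto; lia.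
Qed.

(** * Counting and volume estimates *)

Definition ideal_points d p (T : nat -> (nat -> Z) -> Prop) b alpha e (z : nat -> Z) : Prop :=
  T e z /\ dot d (inj z) b < INR (p ^ e) * alpha.

Lemma scaled_coordinate p k j c : (1 < p)%nat ->
  INR (p ^ k) * (c / INR (p ^ (k + j))) = c / INR (p ^ j).
Proof.
  intros Hp; pose proof (INR_pow_pos p k Hp); pose proof (INR_pow_pos p j Hp).
  rewrite Nat.pow_add_r, mult_INR; field; lra.
Qed.

Lemma ideal_points_card d p Sg T b alpha r e :
  (1 < p)%nat -> is_semigroup d Sg -> p_system p Sg T ->
  (forall x, truncated_body d p Sg T b alpha x ->
     forall i, (i < d)%nat -> Rabs (x i) < INR r) ->
  exists n, has_card (ideal_points d p T b alpha e) n.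
Proof.
  intros Hp [Hpt _] HT Hr.
  destruct (at_most_card (ideal_points d p T b alpha e) ((2 * (r * p ^ e)) ^ d))
    as (n & Hn & _); [|now exists n].
  eapply at_most_incl; [|apply lattice_box_at_most].
  intros z [Hz Dz].
  assert (Hpe : (0 < p ^ e)%nat) by (apply INR_lt; apply INR_pow_pos; easy).
  apply (cell_centered d (p ^ e) r z (fun i => inj z i / INR (p ^ e))); try easy.
  - apply Hpt; now apply (proj1 HT e).
  - now apply cell_corner.
  - apply Hr; split; [now apply lattice_point_p_body|now apply dot_lattice_point].
Qed.

(** With [q = p^(k + j)], a half-open cell of side [1 / p^k] holds [(p^j)^d] points of the grid of
    mesh [1 / q]. A scaled ideal point is itself in the p-body, so its cell is outer. *)
Lemma ideal_points_upper d p Sg T b alpha k j nI n :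
  (1 < p)%nat -> is_semigroup d Sg -> p_system p Sg T ->
  has_card (outer_cell d p Sg T b alpha (p ^ k)) nI ->
  has_card (ideal_points d p T b alpha (k + j)) n ->
  (n <= nI * (p ^ j) ^ d)%nat.
Proof.
  intros Hp [Hpt _] HT HI%has_card_at_most Hn%has_card_at_least.
  refine (at_least_le_at_most _ _ _ Hn _).
  assert (Hf := INR_pow_pos p j Hp); set (f := (p ^ j)%nat) in *.
  assert (Hf0 : (0 < Z.of_nat f)%Z).
  { apply lt_IZR; rewrite <- INR_IZR_INZ; exact Hf. }
  assert (HTpt : forall e z, T e z -> Zpt d z).
  { intros e z Hz; apply Hpt; now apply (proj1 HT e). }
  apply (at_most_fibers
    (fun y z => forall i, (i < d)%nat ->
       (y i * Z.of_nat f <= z i < y i * Z.of_nat f + Z.of_nat f)%Z))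
    with (Q := outer_cell d p Sg T b alpha (p ^ k)); [| |easy].
  - intros z [Hz Dz]; exists (fun i => (z i / Z.of_nat f)%Z).
    assert (Hdiv : forall i, (z i / Z.of_nat f * Z.of_nat f <= z i
      < z i / Z.of_nat f * Z.of_nat f + Z.of_nat f)%Z).
    { intros i; pose proof (Z.div_mod (z i) (Z.of_nat f));
        pose proof (Z.mod_pos_bound (z i) (Z.of_nat f) Hf0); lia. }
    split; [|intros i _; apply Hdiv].
    split; [intros i Hi; now rewrite (HTpt _ z Hz i Hi)|].
    exists (fun i => inj z i / INR (p ^ (k + j))); split; [|split].
    + intros i Hi; unfold inj; rewrite (HTpt _ z Hz i Hi); unfold Rdiv; ring.
    + intros i Hi; rewrite scaled_coordinate by easy; fold f; unfold inj.
      destruct (Hdiv i) as [H1 H2]; apply IZR_le in H1; apply IZR_lt in H2.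
      rewrite plus_IZR in H2; rewrite mult_IZR, <- INR_IZR_INZ in H1, H2.
      assert (E : IZR (z i) / INR f * INR f = IZR (z i)) by (field; lra).
      split; [apply Rmult_le_reg_r with (INR f)|apply Rmult_lt_reg_r with (INR f)];
        try easy; rewrite E; lra.
    + split; [now apply lattice_point_p_body|now apply dot_lattice_point].
  - intros y; eapply at_most_incl;
      [|apply (lattice_box_at_most d (fun i => (y i * Z.of_nat f)%Z) f)].
    intros z [[Hz _] Hy]; split; [now apply HTpt in Hz|exact Hy].
Qed.

(** Past the common threshold, all [(p^j)^d] grid points of the half-open part of an inner cell are
    scaled ideal points below the hyperplane. *)
Lemma ideal_points_lower d p Sg T b alpha k nJ :
  (1 < p)%nat ->
  has_card (inner_cell d p Sg T b alpha (p ^ k)) nJ ->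
  exists e0, forall j n, (e0 <= k + j)%nat ->
    has_card (ideal_points d p T b alpha (k + j)) n ->
    (nJ * (p ^ j) ^ d <= n)%nat.
Proof.
  intros Hp HJ; assert (HJ' := HJ); destruct HJ' as (l & _ & Hl & _).
  destruct (uniform_threshold (fun z e => forall y, Zpt d y ->
    closed_cell d (p ^ k) z (fun i => inj y i / INR (p ^ e)) -> T e y) l) as [e0 He0].
  { intros z (_ & _ & e0 & H)%Hl; exists e0; intros e He y; now apply H. }
  exists e0; intros j n Hj Hn%has_card_at_most.
  refine (at_least_le_at_most _ _ _ _ Hn).
  assert (Hf := INR_pow_pos p j Hp); set (f := (p ^ j)%nat) in *.
  assert (Hf0 : (0 < Z.of_nat f)%Z).
  { apply lt_IZR; rewrite <- INR_IZR_INZ; exact Hf. }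
  (* Including [Zpt d y] in the relation makes [z] determine [y] as a function, also beyond [d]. *)
  apply (at_least_fibers
    (fun y z => Zpt d y /\ lattice_box d (fun i => (y i * Z.of_nat f)%Z) f z))
    with (Q := inner_cell d p Sg T b alpha (p ^ k)).
  - intros y (Hy & _).
    destruct (lattice_box_at_least d (fun i => (y i * Z.of_nat f)%Z) f) as (l' & H1 & H2 & H3).
    exists l'; auto.
  - intros y z Hy [_ [Hz Hbox]].
    assert (Hcell : closed_cell d (p ^ k) y (fun i => inj z i / INR (p ^ (k + j)))).
    { intros i Hi; rewrite scaled_coordinate by easy; fold f; unfold inj.
      destruct (Hbox i Hi) as [H1 H2]; apply IZR_le in H1; apply IZR_lt in H2.
      rewrite plus_IZR in H2; rewrite mult_IZR, <- INR_IZR_INZ in H1, H2.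
      assert (E : IZR (z i) / INR f * INR f = IZR (z i)) by (field; lra).
      split; apply Rmult_le_reg_r with (INR f); try easy; rewrite E; lra. }
    split.
    + apply (He0 y); auto; now apply Hl.
    + apply dot_lattice_point; [easy|]; apply Hy; [|easy].
      intros i Hi; unfold inj; rewrite (Hz i Hi); unfold Rdiv; ring.
  - intros y y' z [Hy [_ H]] [Hy' [_ H']].
    apply functional_extensionality; intros i.
    destruct (le_lt_dec d i) as [Hi|Hi]; [now rewrite Hy, Hy'|].
    specialize (H i Hi); specialize (H' i Hi); nia.
  - now apply has_card_at_least.
Qed.

(** * Volume bounds from cells *)

Lemma closed_cell_sides d m (z : nat -> Z) : (0 < m)%nat ->
  rprod d (fun i => (IZR (z i) + 1) / INR m - IZR (z i) / INR m) = (/ INR m) ^ d.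
Proof.
  intros Hm%lt_0_INR; rewrite <- rprod_const; apply rprod_ext.
  intros i _; field; lra.
Qed.

Lemma closed_cells_cover d m (l : list (nat -> Z)) A s : (0 < m)%nat ->
  cover_sum d A s ->
  cover_sum d (fun x => (exists z, In z l /\ closed_cell d m z x) \/ A x)
    (INR (length l) * (/ INR m) ^ d + s).
Proof.
  intros Hm HA.
  eapply cover_sum_incl; [|apply (cover_sum_list d l
    (fun z i => IZR (z i) / INR m) (fun z i => (IZR (z i) + 1) / INR m)); [| |apply HA]].
  - intros x [(z & Hz & Hx)|Hx]; [left|now right].
    exists z; split; [easy|now apply closed_cell_box].
  - intros z i _; apply Rmult_le_compat_r; [|lra].
    left; apply Rinv_0_lt_compat; now apply lt_0_INR.
  - intros z; now apply closed_cell_sides.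
Qed.

Lemma truncated_body_cover d p Sg T b alpha m nI :
  (0 < m)%nat -> has_card (outer_cell d p Sg T b alpha m) nI ->
  cover_sum d (fun x => Rpt d x /\ truncated_body d p Sg T b alpha x)
    (INR nI * (/ INR m) ^ d).
Proof.
  intros Hm (l & _ & Hl & <-).
  rewrite <- (Rplus_0_r (_ * _)).
  eapply cover_sum_incl; [|apply (closed_cells_cover d m l (fun _ => False) 0 Hm), cover_sum_empty].
  intros x [Rx Bx]; left.
  assert (H : forall i, exists n : Z, ((d <= i)%nat -> n = 0%Z) /\
    ((i < d)%nat -> IZR n <= INR m * x i < IZR n + 1)).
  { intros i; destruct (le_lt_dec d i) as [Hi|Hi].
    - exists 0%Z; split; [easy|lia].
    - destruct (floor_exists (INR m * x i)) as [n Hn]; exists n; split; [lia|easy]. }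
  apply choice in H as [z Hz].
  assert (Hcell : cell d m z x) by (intros i Hi; now apply Hz).
  exists z; split; [|now apply cell_closed_cell].
  apply Hl; split; [intros i; apply Hz|]; now exists x.
Qed.

Lemma grid_covers_box d m r x : (0 < m)%nat -> (0 < r)%nat ->
  in_box d (fun _ => - INR r) (fun _ => INR r) x ->
  exists z, centered_box d (r * m) z /\ closed_cell d m z x.
Proof.
  intros Hm Hr Hx.
  set (N := (r * m)%nat).
  assert (HN : (0 < N)%nat) by (unfold N; nia).
  assert (H : forall i, exists n : Z, ((d <= i)%nat -> n = 0%Z) /\
    ((i < d)%nat -> (- Z.of_nat N <= n < Z.of_nat N)%Z /\
      IZR n <= INR m * x i <= IZR n + 1)).
  { intros i; destruct (le_lt_dec d i) as [Hi|Hi].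
    { exists 0%Z; split; [easy|lia]. }
    specialize (Hx i Hi); apply lt_0_INR in Hm.
    assert (B : - INR N <= INR m * x i <= INR N) by (unfold N; rewrite mult_INR; nra).
    rewrite INR_IZR_INZ in B.
    destruct (Rlt_le_dec (INR m * x i) (IZR (Z.of_nat N))) as [Hlt|Hge].
    - destruct (floor_exists (INR m * x i)) as [n Hn]; exists n; split; [lia|].
      intros _; split; [|lra].
      assert (n < Z.of_nat N)%Z by (apply lt_IZR; lra).
      assert (- Z.of_nat N < n + 1)%Z; [|lia].
      apply lt_IZR; rewrite plus_IZR, opp_IZR; lra.
    (* On the upper face rounding down would leave the cube; the closed cell just below contains the
       point too. *)
    - exists (Z.of_nat N - 1)%Z; split; [lia|]; intros _; split; [lia|].
      rewrite minus_IZR; lra. }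
  apply choice in H as [z Hz]; exists z; split; [split|].
  - intros i; apply Hz.
  - intros i Hi; destruct (Hz i) as [_ H]; specialize (H Hi).
    fold N; lia.
  - intros i Hi; now apply Hz.
Qed.

(* Complementing inside a large cube: a cover of the body together with the cells
   that are not inner covers the cube. *)
Lemma inner_cells_le_cover d p Sg T b alpha r m nJ s :
  (0 < m)%nat -> (0 < r)%nat ->
  (forall x, truncated_body d p Sg T b alpha x ->
     forall i, (i < d)%nat -> Rabs (x i) < INR r) ->
  has_card (inner_cell d p Sg T b alpha m) nJ ->
  cover_sum d (fun x => Rpt d x /\ truncated_body d p Sg T b alpha x) s ->
  INR nJ * (/ INR m) ^ d <= s.
Proof.
  intros Hm Hr Hbound HJ Hs.
  set (J := inner_cell d p Sg T b alpha m).
  set (G := lattice_box_list d (fun _ => (- Z.of_nat (r * m))%Z) (2 * (r * m))).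
  set (G1 := filter (fun z => decide (J z)) G).
  set (G2 := filter (fun z => negb (decide (J z))) G).
  assert (HG : (length G1 + length G2 = (2 * (r * m)) ^ d)%nat).
  { unfold G1, G2; rewrite filter_length; apply length_lattice_box_list. }
  assert (HJ1 : (nJ <= length G1)%nat).
  { apply has_card_at_least in HJ; apply (at_least_le_at_most J); [easy|].
    exists G1; split; [|easy]; intros z Hz; apply filter_In.
    rewrite decide_spec; split; [|easy].
    apply in_lattice_box_list.
    destruct (inner_cell_outer_cell d p Sg T b alpha m z Hm Hz) as (Zz & x & _ & Hx & Bx).
    apply (cell_centered d m r z x); auto. }
  assert (Hcov := closed_cells_cover d m G2 _ _ Hm Hs).
  apply cover_sum_bound in Hcov as (used & a & c & Hac & Hcov & Hsum).
  assert (Hrpos := lt_0_INR r Hr); assert (Hmpos := lt_0_INR m Hm).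
  assert (HV : rprod d (fun _ => INR r - - INR r)
    <= INR (length G2) * (/ INR m) ^ d + s).
  { refine (box_volume_le_cover d used a c (fun _ => - INR r) (fun _ => INR r) _
      _ Hac _ Hsum); [intros; lra|].
    intros x Rx Hx; apply Hcov.
    destruct (grid_covers_box d m r x Hm Hr Hx) as (z & Hz & Hzx).
    destruct (classic (J z)) as [HJz|HJz].
    - right; split; [easy|]; now apply HJz.
    - left; exists z; split; [|easy]; apply filter_In; split.
      + now apply in_lattice_box_list.
      + destruct (decide (J z)) eqn:E; [|easy]; now apply (proj1 (decide_spec _)) in E. }
  rewrite rprod_const in HV.
  apply (f_equal INR) in HG; rewrite plus_INR, pow_INR, !mult_INR in HG; simpl (INR 2) in HG.
  replace ((1 + 1) * (INR r * INR m)) with ((INR r - - INR r) * INR m) in HG by ring.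
  rewrite Rpow_mult_distr in HG.
  assert (E : INR m ^ d * (/ INR m) ^ d = 1).
  { rewrite <- Rpow_mult_distr, Rinv_r, pow1 by lra; easy. }
  assert (0 < (/ INR m) ^ d) by (apply pow_lt; now apply Rinv_0_lt_compat).
  apply le_INR in HJ1.
  set (w := (/ INR m) ^ d) in *; set (V := (INR r - - INR r) ^ d) in *.
  (* The cells tile the cube, so cancelling those of [G2] bounds those of [G1], which include all
     inner cells. *)
  assert (EV : V = (INR (length G1) + INR (length G2)) * w).
  { rewrite HG, Rmult_assoc, E; ring. }
  nra.
Qed.

(** * The limit *)

Theorem mainTheorem6 (d p : nat) (S : (nat -> Z) -> Prop)
    (T : nat -> (nat -> Z) -> Prop) (b : nat -> R) (alpha : R) :
  prime (Z.of_nat p) ->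
  standard d S ->
  p_system p S T ->
  pointing_vector d (Scone d S) b ->
  0 <= alpha ->
  exists (N : nat -> nat) (v : R),
    (forall e, has_card (fun z => T e z /\ dot d (inj z) b < INR (p ^ e) * alpha) (N e)) /\
    volume d (fun x => p_body d p S T x /\ dot d x b < alpha) v /\
    Un_cv (fun e => INR (N e) / INR (p ^ e) ^ d) v.
Proof.
  intros Hprime Hstd HT Hb _.
  assert (Hp : (1 < p)%nat) by (destruct Hprime; lia).
  assert (HS := proj1 Hstd).
  destruct (standard_deep_point d S Hstd) as [s0 Hs0].
  destruct (truncated_body_bounded d p S T b alpha Hp HS HT Hb) as (r & Hr & Hbound).
  destruct (crossing_cells_negligible d b alpha s0 r) as (C & HC & Hcross).
  assert (Hpk : forall k, (0 < p ^ k)%nat) by (intros k; apply INR_lt, INR_pow_pos, Hp).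
  assert (HN : forall e, exists n, has_card (ideal_points d p T b alpha e) n).
  { intros e; now apply (ideal_points_card d p S T b alpha r). }
  apply choice in HN as [N HN].
  (* Any grid would do here: one finite cover shows that the volume exists. *)
  destruct (outer_cells_card d p S T b alpha r (p ^ 0) (Hpk O) Hbound) as [n0 Hn0].
  destruct (volume_exists d (truncated_body d p S T b alpha) _
    (truncated_body_cover d p S T b alpha _ _ (Hpk O) Hn0)) as [v Hv].
  exists N, v; split; [exact HN|split; [exact Hv|]].
  intros eps Heps.
  (* As [C / eps < k <= p^k = m], the crossing cells have total volume below [eps]. *)
  destruct (nat_above (C / eps)) as (k & _ & Hk).
  set (m := (p ^ k)%nat).
  assert (Hm : (0 < m)%nat) by apply Hpk.
  assert (Hmpos := lt_0_INR m Hm).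
  assert (Hkm : INR k <= INR m).
  { apply le_INR; pose proof (Nat.pow_gt_lin_r p k Hp); unfold m; lia. }
  destruct (outer_cells_card d p S T b alpha r m Hm Hbound) as [nI HI].
  destruct (at_most_card (inner_cell d p S T b alpha m) nI) as (nJ & HJ & _).
  { eapply at_most_incl; [|apply has_card_at_most, HI].
    intros z; now apply inner_cell_outer_cell. }
  destruct (Hcross m Hm) as (nB & HB & HBm).
  assert (HIJ : (nI <= nJ + nB)%nat).
  { apply (at_least_le_at_most (outer_cell d p S T b alpha m));
      [now apply has_card_at_least|].
    eapply at_most_incl; [|apply at_most_or; [|apply HB]].
    - intros z Hz; destruct (outer_cell_cases d p S T b alpha s0 m z Hp HS HT Hs0 Hm Hz)
        as [H|H]; [left; exact H|right; split; [|exact H]].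
      destruct Hz as (Zz & x & _ & Hx & Bx); apply (cell_centered d m r z x); auto.
    (* The translation has an inverse, so cells translated to inner cells are no more numerous than
       the inner cells. *)
    - apply (at_most_preimage (shift3 s0) (fun z i => (z i - 3 * s0 i)%Z) _
        (inner_cell d p S T b alpha m)); [|now apply has_card_at_most].
      intros z Hz; split; [exact Hz|].
      apply functional_extensionality; intros i; unfold shift3; ring. }
  set (w := (/ INR m) ^ d).
  assert (Hw : 0 < w) by (apply pow_lt; now apply Rinv_0_lt_compat).
  assert (Ew : INR m ^ d * w = 1).
  { unfold w; rewrite <- Rpow_mult_distr, Rinv_r, pow1 by lra; easy. }
  assert (Hgap : INR nI * w - INR nJ * w < eps).
  { apply le_INR in HIJ; rewrite plus_INR in HIJ.
    assert (H1 : INR nB * w * INR m <= C).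
    { apply Rmult_le_compat_r with (r := w) in HBm; [|lra].
      rewrite Rmult_assoc in HBm; nra. }
    assert (H2 : C < eps * INR m).
    { apply Rmult_lt_compat_r with (r := eps) in Hk; [|easy].
      unfold Rdiv in Hk; rewrite Rmult_assoc, Rinv_l in Hk by lra; nra. }
    assert (INR nB * w < eps) by (apply Rmult_lt_reg_r with (INR m); lra).
    nra. }
  (* The two clauses of [is_inf]: the outer cells are one cover, and the inner cells bound every
     cover sum from below. *)
  assert (Hv1 : v <= INR nI * w).
  { apply Hv; now apply (truncated_body_cover d p S T b alpha). }
  assert (Hv2 : INR nJ * w <= v).
  { apply Hv; intros s Hs.
    now apply (inner_cells_le_cover d p S T b alpha r m nJ s Hm Hr Hbound). }
  destruct (ideal_points_lower d p S T b alpha k nJ Hp HJ) as [e0 He0].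
  exists (e0 + k)%nat; intros e He.
  set (j := (e - k)%nat); replace e with (k + j)%nat by lia.
  assert (Hup := ideal_points_upper d p S T b alpha k j nI _ Hp HS HT HI (HN (k + j)%nat)).
  assert (Hlo := He0 j _ ltac:(lia) (HN (k + j)%nat)).
  apply le_INR in Hup, Hlo; rewrite mult_INR, pow_INR in Hup, Hlo.
  rewrite Nat.pow_add_r, mult_INR, Rpow_mult_distr; fold m.
  assert (Hf := INR_pow_pos p j Hp).
  set (n := INR (N (k + j)%nat)) in *; set (f := INR (p ^ j)) in *.
  assert (Hfd : 0 < f ^ d) by now apply pow_lt.
  replace (n / (INR m ^ d * f ^ d)) with (n / f ^ d * w).
  2: { apply Rmult_eq_reg_l with (INR m ^ d); [|nra].
       replace (INR m ^ d * (n / f ^ d * w)) with (INR m ^ d * w * (n / f ^ d)) by ring.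
       rewrite Ew; field; split; [lra|nra]. }
  assert (E : n / f ^ d * f ^ d = n) by (field; lra).
  assert (n / f ^ d <= INR nI) by (apply Rmult_le_reg_r with (f ^ d); [easy|]; lra).
  assert (INR nJ <= n / f ^ d) by (apply Rmult_le_reg_r with (f ^ d); [easy|]; lra).
  (* The normalised count and [v] both lie between [INR nJ * w] and [INR nI * w], less than [eps]
     apart. *)
  unfold Rdist; apply Rabs_def1; nra.
Qed.
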